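(* Let $p$ be a prime number and suppose $(A, I)$ is a bounded $p$-adic prism. Then the ideal $\mathfrak{a} := I + (p) \subseteq A$ is weakly proregular.
   Context: Rings are commutative and not assumed noetherian. Let $\mathbb{Z}_{(p)}\subseteq\mathbb{Q}$ be the localization of $\mathbb{Z}$ at the prime ideal $(p)$ (not its completion). A $p$-adic prism is a pair $(A,I)$, where $A$ is a $\mathbb{Z}_{(p)}$-ring and $I\subseteq A$ is an ideal, such that: (i) $I$ defines an effective Cartier divisor on $\operatorname{Spec}(A)$; i.e. there are $s_1,\ldots,s_n\in A$ with $\sum_i A s_i=A$ such that each ideal $I_{s_i}=A_{s_i}\otimes_A I\subseteq A_{s_i}=A[s_i^{-1}]$ is generated by a single regular element (non-zero-divisor) of $A_{s_i}$. (ii) $A$ is sequentially derived $\mathfrak{a}$-adically complete, where $\mathfrak{a}:=I+(p)$ (a finitely generated ideal); i.e. for a finite sequence $\boldsymbol{a}=(a_1,\ldots,a_n)$ generating $\mathfrak{a}$ (the choice does not matter), the morphism $A\to\operatorname{RHom}_A(\operatorname{K}^{\vee}_{\infty}(A;\boldsymbol{a}),A)$ in the derived category $\mathsf{D}(A)$ induced by the augmentation $\operatorname{K}^{\vee}_{\infty}(A;\boldsymbol{a})\to A$ is an isomorphism. Here $\operatorname{K}^{\vee}_{\infty}(A;\boldsymbol{a})=\bigotimes_{i}(A\to A[a_i^{-1}])$ (tensor over $A$, each factor in degrees $0,1$ with differential the localization map), and the augmentation is the projection onto its degree $0$ component $A$. (iii) (Frobenius lift condition) $A$ is equipped with a $\delta$-structure,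 i.e. a map $\delta:A\to A$ with $\delta(0)=\delta(1)=0$, $\delta(xy)=x^p\delta(y)+y^p\delta(x)+p\,\delta(x)\delta(y)$, $\delta(x+y)=\delta(x)+\delta(y)+\frac{x^p+y^p-(x+y)^p}{p}$, and with $\phi(x):=x^p+p\,\delta(x)$ one has $p\in I+\phi(I)A$. The prism is bounded if the ring $A/I$ has bounded $p$-torsion: there is $j_0\in\mathbb{N}$ such that for all $j\ge j_0$, $\{x\in A/I: p^jx=0\}=\{x\in A/I:p^{j_0}x=0\}$. Weak proregularity: for $a\in A$, $\operatorname{K}(A;a)$ is the complex $A \xrightarrow{a\cdot} A$ in degrees $-1, 0$. For $j\ge i$ there is a homomorphism $\mu_{j,i}^{a}:\operatorname{K}(A;a^j)\to \operatorname{K}(A;a^i)$ that is the identity in degree $0$ and multiplication by $a^{j-i}$ in degree $-1$. For $\boldsymbol{a}=(a_1,\ldots,a_n)$, $\operatorname{K}(A;\boldsymbol{a}) := \operatorname{K}(A;a_1)\otimes_A\cdots\otimes_A \operatorname{K}(A;a_n)$, and with $\boldsymbol{a}^i := (a_1^i,\ldots,a_n^i)$ the tensor product homomorphisms $\mu_{j,i}^{a_1}\otimes\cdots\otimes\mu_{j,i}^{a_n}:\operatorname{K}(A;\boldsymbol{a}^j)\to\operatorname{K}(A;\boldsymbol{a}^i)$, for $j\ge i$, make $\{\operatorname{K}(A;\boldsymbol{a}^i)\}_{i\in\mathbb{N}}$ an inverse system. An inverse system $\{N_i\}_{i\in\mathbb{N}}$ of modules is pro-zero if for every $i$ there is $j\ge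 i$ with $N_j\to N_i$ zero. The sequence $\boldsymbol{a}$ is weakly proregular if for every $q<0$ the inverse system $\{\operatorname{H}^q(\operatorname{K}(A;\boldsymbol{a}^i))\}_{i\in\mathbb{N}}$ is pro-zero. An ideal is weakly proregular if it is generated by some finite weakly proregular sequence. *)

(* Defs.v *)
From HB Require Import structures.
From mathcomp Require Import all_boot all_order all_algebra.
From mathcomp Require Import generic_quotient ring_quotient.
From mathcomp Require Import boolp classical_sets.
From mathcomp Require Import zify.

Set Implicit Arguments.
Unset Strict Implicit.
Unset Printing Implicit Defensive.

Import Order.TTheory GRing.Theory Num.Theory.
Local Open Scope ring_scope.
Local Open Scope quotient_scope.

Definition Zlocal_pred (p : nat) : {pred rat} :=
  fun q => coprime p `|denq q|%N.

Lemma denq_dvd (q : rat) (m : int) (n : nat) :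
  q * n%:R = m%:~R -> (`|denq q| %| n)%N.
Proof.
move=> e.
have: (numq q * n%:Z)%:~R = (m * denq q)%:~R :> rat.
  rewrite !rmorphM /= -e -[X in _ = X * _ * _]divq_num_den -pmulrn.
  by rewrite mulrAC divfK // intr_eq0 denq_neq0.
move=> /intr_inj /(congr1 absz); rewrite !abszM absz_nat => e2.
have : (`|denq q| %| `|numq q| * n)%N by rewrite e2 dvdn_mull.
by rewrite Gauss_dvdr // coprime_sym coprime_num_den.
Qed.

Lemma Zlocal_subring p : subring_closed (Zlocal_pred p).
Proof.
have denE (q : rat) : q * (`|denq q|%N)%:R = (numq q)%:~R.
  rewrite -[X in X * _]divq_num_den pmulrn absz_denq divfK //.
  by rewrite intr_eq0 denq_neq0.
have H (x y z : rat) m : Zlocal_pred p x -> Zlocal_pred p y ->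
    z * (`|denq x| * `|denq y|)%N%:R = m%:~R -> Zlocal_pred p z.
  move=> hx hy /denq_dvd hz; rewrite /Zlocal_pred.
  by apply: (coprime_dvdr hz); rewrite coprimeMr; apply/andP.
split=> [|x y hx hy|x y hx hy]; first by rewrite unfold_in /Zlocal_pred coprimen1.
  apply: (H x y _ (numq x * `|denq y|%N%:Z - numq y * `|denq x|%N%:Z)) => //.
  rewrite rmorphB !rmorphM /= -!denE.
  rewrite -!pmulrn mulrBl mulrA; congr (_ - _).
  by rewrite [X in y * X]mulrC mulrA.
apply: (H x y _ (numq x * numq y)) => //.
by rewrite !rmorphM /= -!denE mulrACA.
Qed.

HB.instance Definition _ p :=
  GRing.isSubringClosed.Build rat (Zlocal_pred p) (@Zlocal_subring p).

Record Zlocal (p : nat) :=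
  ZLocal { Zlocal_val :> rat; _ : Zlocal_val \in Zlocal_pred p }.

HB.instance Definition _ p := [isSub for @Zlocal_val p].
HB.instance Definition _ p := [Choice of Zlocal p by <:].
HB.instance Definition _ p := [SubChoice_isSubComNzRing of Zlocal p by <:].

Section ModQuot.
Variables (A : comPzRingType) (M : lmodType A) (S : submodClosed M).

Definition submod_pred : {pred M} := fun x => x \in S.
Fact submod_zmod_closed : zmod_closed submod_pred.
Proof. exact: GRing.submod_closedB (submodClosedP S). Qed.
HB.instance Definition _ :=
  GRing.isZmodClosed.Build M submod_pred submod_zmod_closed.

Definition modquot : Type := {ideal_quot submod_pred}.

HB.instance Definition _ := Choice.on modquot.
HB.instance Definition _ := GRing.Zmodule.on modquot.
HB.instance Definition _ : Quotient M modquot := Quotient.on modquot.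

Definition mq_scale (a : A) (x : modquot) : modquot :=
  \pi_modquot (a *: repr x).

Lemma mq_pi_eq (x y : M) : x - y \in S -> \pi_modquot x = \pi_modquot y.
Proof. by move=> h; apply/eqP; rewrite -[_ == _](Quotient.idealrBE submod_pred). Qed.

Lemma mq_eq_pi (x y : M) : \pi_modquot x = \pi_modquot y -> x - y \in S.
Proof. by move=> /eqP; rewrite -[_ == _]Quotient.idealrBE. Qed.

Lemma mq_piD (x y : M) :
  \pi_modquot (x + y) = \pi_modquot x + \pi_modquot y :> modquot.
Proof. by rewrite (Quotient.pi_add submod_pred). Qed.

Lemma mq_scaleE a x : mq_scale a (\pi_modquot x) = \pi_modquot (a *: x).
Proof.
apply: mq_pi_eq; rewrite -scalerBr; apply: rpredZ.
by apply: mq_eq_pi; rewrite reprK.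
Qed.

Fact mq_scalerA a b v : mq_scale a (mq_scale b v) = mq_scale (a * b) v.
Proof. by rewrite -[v]reprK (mq_scaleE b) !mq_scaleE scalerA. Qed.
Fact mq_scale1r : left_id 1 mq_scale.
Proof. by move=> v; rewrite -[v]reprK mq_scaleE scale1r. Qed.
Fact mq_scalerDr : right_distributive mq_scale +%R.
Proof.
by move=> a v w; rewrite -[v]reprK -[w]reprK -mq_piD !mq_scaleE scalerDr mq_piD.
Qed.
Fact mq_scalerDl v : {morph mq_scale^~ v : a b / a + b}.
Proof. by move=> a b; rewrite -[v]reprK !mq_scaleE scalerDl mq_piD. Qed.

HB.instance Definition _ := GRing.Zmodule_isLmodule.Build A modquot
  mq_scalerA mq_scale1r mq_scalerDr mq_scalerDl.

Definition mq_proj (x : M) : modquot := \pi_modquot x.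
Fact mq_proj_linear : linear mq_proj.
Proof. by move=> a x y; rewrite /mq_proj mq_piD -mq_scaleE. Qed.
HB.instance Definition _ := GRing.isLinear.Build A M modquot *:%R mq_proj
  mq_proj_linear.

Section Lift.
Variables (N : lmodType A) (g : {linear M -> N}).
Hypothesis gS : forall x, x \in S -> g x = 0.

Definition mq_lift of (forall x, x \in S -> g x = 0) :=
  fun x : modquot => g (repr x).

Lemma mq_liftE x : mq_lift gS (mq_proj x) = g x.
Proof.
apply/eqP; rewrite -subr_eq0 -raddfB; apply/eqP/gS.
by apply: mq_eq_pi; rewrite reprK.
Qed.

Fact mq_lift_linear : linear (mq_lift gS).
Proof.
move=> a x y; rewrite -[x]reprK -[y]reprK.
by rewrite -/(mq_proj _) -/(mq_proj _) -linearP !mq_liftE linearP.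
Qed.
HB.instance Definition _ := GRing.isLinear.Build A modquot N *:%R
  (mq_lift gS) mq_lift_linear.
End Lift.

End ModQuot.

Section KerIm.
Variables (A : comPzRingType) (M N : lmodType A) (f : {linear M -> N}).

Definition lker_pred : {pred M} := fun x => f x == 0.
Fact lker_closed : submod_closed lker_pred.
Proof.
split=> [|a x y]; rewrite !unfold_in ?linear0 // => /eqP hx /eqP hy.
by rewrite linearP hx hy scaler0 addr0.
Qed.
HB.instance Definition _ :=
  GRing.isSubmodClosed.Build A M lker_pred lker_closed.

Record lker := LKer { lker_val :> M; _ : lker_val \in lker_pred }.
HB.instance Definition _ := [isSub for lker_val].
HB.instance Definition _ := [Choice of lker by <:].
HB.instance Definition _ := [SubChoice_isSubLmodule of lker by <:].

Definition limg_pred : {pred N} := fun y => `[< exists x, f x = y >].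
Fact limg_closed : submod_closed limg_pred.
Proof.
split=> [|a _ _ /asboolP[x <-] /asboolP[y <-]]; apply/asboolP.
  by exists 0; rewrite linear0.
by exists (a *: x + y); rewrite linearP.
Qed.
HB.instance Definition _ :=
  GRing.isSubmodClosed.Build A N limg_pred limg_closed.

End KerIm.

Section Hom.
Variables (A : comPzRingType) (M N : lmodType A).

Definition lhom : Type := {linear M -> N}.
HB.instance Definition _ := gen_eqMixin lhom.
HB.instance Definition _ := gen_choiceMixin lhom.

Lemma lhomP (f g : {linear M -> N}) : f =1 g -> f = g.
Proof.
case: f g => f [[f1] [f2]] [g [[g1] [g2]]] /= /funext e.
case: _ / e in g1 g2 *.
by rewrite (Prop_irrelevance f1 g1) (Prop_irrelevance f2 g2).
Qed.

Definition lhom_mk (f : M -> N) (h : linear f) : lhom :=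
  HB.pack f (GRing.isLinear.Build A M N *:%R f h).

Fact lhom0_subproof : linear (fun _ : M => 0 : N).
Proof. by move=> a x y; rewrite scaler0 addr0. Qed.
Fact lhomN_subproof (f : lhom) : linear (fun x : M => - f x : N).
Proof. by move=> a x y; rewrite linearP opprD scalerN. Qed.
Fact lhomD_subproof (f g : lhom) : linear (fun x : M => f x + g x : N).
Proof. by move=> a x y; rewrite !linearP scalerDr addrACA. Qed.
Fact lhomZ_subproof (c : A) (f : lhom) : linear (fun x : M => c *: f x : N).
Proof. by move=> a x y; rewrite linearP scalerDr !scalerA mulrC. Qed.

Definition lhom0 := lhom_mk lhom0_subproof.
Definition lhomN f := lhom_mk (lhomN_subproof f).
Definition lhomD f g := lhom_mk (lhomD_subproof f g).
Definition lhomZ c f := lhom_mk (lhomZ_subproof c f).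

Fact lhom_addA : associative lhomD.
Proof. by move=> f g h; apply: lhomP => x /=; rewrite addrA. Qed.
Fact lhom_addC : commutative lhomD.
Proof. by move=> f g; apply: lhomP => x /=; rewrite addrC. Qed.
Fact lhom_add0 : left_id lhom0 lhomD.
Proof. by move=> f; apply: lhomP => x /=; rewrite add0r. Qed.
Fact lhom_addN : left_inverse lhom0 lhomN lhomD.
Proof. by move=> f; apply: lhomP => x /=; rewrite addNr. Qed.
HB.instance Definition _ :=
  GRing.isZmodule.Build lhom lhom_addA lhom_addC lhom_add0 lhom_addN.

Fact lhom_scaleA a b v : lhomZ a (lhomZ b v) = lhomZ (a * b) v.
Proof. by apply: lhomP => x /=; rewrite scalerA. Qed.
Fact lhom_scale1 : left_id 1 lhomZ.
Proof. by move=> f; apply: lhomP => x /=; rewrite scale1r. Qed.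
Fact lhom_scaleDr : right_distributive lhomZ +%R.
Proof. by move=> a f g; apply: lhomP => x /=; rewrite scalerDr. Qed.
Fact lhom_scaleDl v : {morph lhomZ^~ v : a b / a + b}.
Proof. by move=> a b; apply: lhomP => x /=; rewrite scalerDl. Qed.
HB.instance Definition _ := GRing.Zmodule_isLmodule.Build A lhom
  lhom_scaleA lhom_scale1 lhom_scaleDr lhom_scaleDl.

End Hom.

Section Tensor.
Variables (A : comPzRingType) (M N : lmodType A).

(* A list stands for the formal sum of its entries m (x) n; the relation is the
   smallest congruence imposing commutativity and A-bilinearity. *)
Inductive tens_rel : seq (M * N) -> seq (M * N) -> Prop :=
| tr_refl s : tens_rel s s
| tr_sym s t : tens_rel s t -> tens_rel t s
| tr_trans t s u : tens_rel s t -> tens_rel t u -> tens_rel s u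
| tr_cat s s' t t' : tens_rel s s' -> tens_rel t t' ->
    tens_rel (s ++ t) (s' ++ t')
| tr_catC s t : tens_rel (s ++ t) (t ++ s)
| tr_zero n : tens_rel [:: (0, n)] [::]
| tr_addl m m' n : tens_rel [:: (m + m', n)] [:: (m, n); (m', n)]
| tr_addr m n n' : tens_rel [:: (m, n + n')] [:: (m, n); (m, n')]
| tr_scale a m n : tens_rel [:: (a *: m, n)] [:: (m, a *: n)].

Definition tens_eq : rel (seq (M * N)) := fun s t => `[< tens_rel s t >].

Fact tens_eq_refl : reflexive tens_eq.
Proof. by move=> s; apply/asboolP; apply: tr_refl. Qed.
Fact tens_eq_sym : symmetric tens_eq.
Proof. by move=> s t; apply/asboolP/asboolP; apply: tr_sym. Qed.
Fact tens_eq_trans : transitive tens_eq.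
Proof.
by move=> t s u /asboolP h /asboolP k; apply/asboolP; apply: tr_trans h k.
Qed.

Canonical tens_equiv := EquivRel tens_eq tens_eq_refl tens_eq_sym tens_eq_trans.

Definition tensor : Type := {eq_quot tens_eq}.
HB.instance Definition _ := Choice.on tensor.
HB.instance Definition _ := Quotient.on tensor.

Lemma tens_piP s t : (\pi_tensor s = \pi_tensor t) <-> tens_rel s t.
Proof.
split=> [/eqP|h]; first by rewrite piE => /asboolP.
by apply/eqP; rewrite piE; apply/asboolP.
Qed.

Lemma tens_repr s : tens_rel (repr (\pi_tensor s)) s.
Proof. by apply/tens_piP; rewrite reprK. Qed.

Definition tens0 : tensor := \pi_tensor [::].
Definition tensD (x y : tensor) : tensor := \pi_tensor (repr x ++ repr y).
Definition tensZ (a : A) (x : tensor) : tensor :=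
  \pi_tensor [seq (a *: u.1, u.2) | u <- repr x].

Lemma tensDE s t : tensD (\pi_tensor s) (\pi_tensor t) = \pi_tensor (s ++ t).
Proof. by apply/tens_piP; apply: tr_cat; apply: tens_repr. Qed.

Lemma tens_rel_map a s t : tens_rel s t ->
  tens_rel [seq (a *: u.1, u.2) | u <- s] [seq (a *: u.1, u.2) | u <- t].
Proof.
elim=> {s t} /= [s|s t _|t s u _ h _|s s' t t' _ h _ k|s t|n|m m' n|m n n'|b m n].
- exact: tr_refl.
- exact: tr_sym.
- exact: tr_trans.
- by rewrite !map_cat; apply: tr_cat.
- by rewrite !map_cat; apply: tr_catC.
- by rewrite scaler0; apply: tr_zero.
- by rewrite scalerDr; apply: tr_addl.
- exact: tr_addr.
- by rewrite scalerA mulrC -scalerA; apply: tr_scale.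
Qed.

Lemma tensZE a s :
  tensZ a (\pi_tensor s) = \pi_tensor [seq (a *: u.1, u.2) | u <- s].
Proof. by apply/tens_piP; apply: tens_rel_map; apply: tens_repr. Qed.

Fact tens_addA : associative tensD.
Proof.
move=> x y z; rewrite -[x]reprK -[y]reprK -[z]reprK.
by rewrite (tensDE (repr y)) (tensDE (repr x) (repr y)) !tensDE catA.
Qed.
Fact tens_addC : commutative tensD.
Proof.
move=> x y; rewrite -[x]reprK -[y]reprK !tensDE.
by apply/tens_piP; apply: tr_catC.
Qed.
Fact tens_add0 : left_id tens0 tensD.
Proof. by move=> x; rewrite -[x]reprK tensDE. Qed.

Lemma tens_rel_flatten (I : Type) (f g : I -> seq (M * N)) (s : seq I) :
  (forall i, tens_rel (f i) (g i)) ->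
  tens_rel (flatten (map f s)) (flatten (map g s)).
Proof.
by move=> h; elim: s => [|i s ih] /=; [apply: tr_refl | apply: tr_cat].
Qed.

Lemma tens_rel_add2 (f g : M * N -> M * N) s :
  tens_rel ([seq f u | u <- s] ++ [seq g u | u <- s])
           (flatten [seq [:: f u; g u] | u <- s]).
Proof.
elim: s => [|u s ih] /=; first exact: tr_refl.
rewrite -[_ :: _ ++ _]/([:: f u] ++ (_ ++ _)) -[_ :: _ :: _]/([:: f u] ++ ([:: g u] ++ _)).
apply: tr_cat; first exact: tr_refl.
apply: (tr_trans (t := ([:: g u] ++ map g s) ++ map f s)); first exact: tr_catC.
rewrite -catA; apply: tr_cat; first exact: tr_refl.
by apply: tr_trans ih; apply: tr_catC.
Qed.

Lemma flatten_seq1 (I T : Type) (f : I -> T) s :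
  flatten [seq [:: f i] | i <- s] = map f s.
Proof. by elim: s => //= i s ->. Qed.

Lemma tensZDl a b x : tensZ (a + b) x = tensD (tensZ a x) (tensZ b x).
Proof.
rewrite -[x]reprK !tensZE tensDE; apply/tens_piP; set s := repr x.
apply: tr_trans (tr_sym (tens_rel_add2 _ _ _)).
rewrite -flatten_seq1; apply: tens_rel_flatten => -[m n] /=.
by rewrite scalerDl; apply: tr_addl.
Qed.

Lemma tensZ0 x : tensZ 0 x = tens0.
Proof.
rewrite -[x]reprK tensZE; apply/tens_piP; elim: (repr x) => [|[m n] s ih] /=.
  exact: tr_refl.
rewrite scale0r -[_ :: _]/([:: (0, n)] ++ _) -[X in tens_rel _ X]cat0s.
by apply: tr_cat => //; apply: tr_zero.
Qed.

Fact tens_scale1 : left_id 1 tensZ.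
Proof.
move=> x; rewrite -[x]reprK tensZE; congr (\pi_tensor _); rewrite -[RHS]map_id.
by apply: eq_map => -[m n]; rewrite /= scale1r.
Qed.
Fact tens_addN : left_inverse tens0 (tensZ (-1)) tensD.
Proof. by move=> x; rewrite -{2}[x]tens_scale1 -tensZDl addNr tensZ0. Qed.

HB.instance Definition _ :=
  GRing.isZmodule.Build tensor tens_addA tens_addC tens_add0 tens_addN.

Fact tens_scaleA a b v : tensZ a (tensZ b v) = tensZ (a * b) v.
Proof.
rewrite -[v]reprK (tensZE b) !tensZE -map_comp; congr (\pi_tensor _).
by apply: eq_map => -[m n] /=; rewrite scalerA.
Qed.
Fact tens_scaleDr : right_distributive tensZ +%R.
Proof.
by move=> a x y; rewrite -[x]reprK -[y]reprK [_ + _]tensDE !tensZE map_cat -tensDE.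
Qed.

HB.instance Definition _ := GRing.Zmodule_isLmodule.Build A tensor
  tens_scaleA tens_scale1 tens_scaleDr (fun v a b => tensZDl a b v).

Definition tens (m : M) (n : N) : tensor := \pi_tensor [:: (m, n)].

Lemma tensDl m m' n : tens (m + m') n = tens m n + tens m' n.
Proof. by rewrite [RHS]tensDE; apply/tens_piP; apply: tr_addl. Qed.
Lemma tensDr m n n' : tens m (n + n') = tens m n + tens m n'.
Proof. by rewrite [RHS]tensDE; apply/tens_piP; apply: tr_addr. Qed.
Lemma tensZl a m n : tens (a *: m) n = a *: tens m n.
Proof. by rewrite [RHS]tensZE. Qed.
Lemma tensZr a m n : tens m (a *: n) = a *: tens m n.
Proof. by rewrite -tensZl; apply/esym/tens_piP; apply: tr_scale. Qed.

Lemma tens_piE s : \pi_tensor s = \sum_(u <- s) tens u.1 u.2.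
Proof.
elim: s => [|[m n] s ih]; first by rewrite big_nil.
by rewrite big_cons -ih [RHS]tensDE.
Qed.

Lemma tensE (x : tensor) : x = \sum_(u <- repr x) tens u.1 u.2.
Proof. by rewrite -tens_piE reprK. Qed.

Section Lift.
Variables (P : lmodType A) (b : M -> N -> P).

Definition bilin := [/\ forall m m' n, b (m + m') n = b m n + b m' n,
  forall m n n', b m (n + n') = b m n + b m n',
  forall a m n, b (a *: m) n = a *: b m n &
  forall a m n, b m (a *: n) = a *: b m n].

Hypothesis hb : bilin.

Definition tens_lift of bilin :=
  fun x : tensor => \sum_(u <- repr x) b u.1 u.2.

Lemma tens_rel_lift s t : tens_rel s t ->
  \sum_(u <- s) b u.1 u.2 = \sum_(u <- t) b u.1 u.2.
Proof.
have [bDl bDr bZl bZr] := hb.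
elim=> {s t} //= [t s u _ -> _ -> //|s s' t t' _ h _ k|s t|n|m m' n|m n n'|a m n].
- by rewrite !big_cat /= h k.
- by rewrite !big_cat /= addrC.
- by rewrite big_seq1 big_nil -(scale0r 0) bZl scale0r.
- by rewrite big_seq1 big_cons big_seq1 bDl.
- by rewrite big_seq1 big_cons big_seq1 bDr.
- by rewrite !big_seq1 bZl bZr.
Qed.

Lemma tens_liftE m n : tens_lift hb (tens m n) = b m n.
Proof. by rewrite /tens_lift (tens_rel_lift (tens_repr _)) big_seq1. Qed.

Fact tens_lift_linear : linear (tens_lift hb).
Proof.
have [_ _ bZl _] := hb.
move=> a x y; rewrite /tens_lift.
have e : tens_rel (repr (a *: x + y)) ([seq (a *: u.1, u.2) | u <- repr x] ++ repr y).
  apply/tens_piP; rewrite reprK -tensDE reprK -tensZE reprK.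
  by [].
rewrite (tens_rel_lift e) big_cat big_map scaler_sumr /=.
by congr (_ + _); apply: eq_bigr => u _; rewrite bZl.
Qed.
HB.instance Definition _ := GRing.isLinear.Build A tensor P *:%R
  (tens_lift hb) tens_lift_linear.
End Lift.

Lemma tens_hom_ext (P : lmodType A) (f g : {linear tensor -> P}) :
  (forall m n, f (tens m n) = g (tens m n)) -> f =1 g.
Proof.
by move=> h x; rewrite [x]tensE !linear_sum; apply: eq_bigr => u _.
Qed.

End Tensor.

Section TensorMap.
Variables (A : comPzRingType) (M M' N N' : lmodType A).
Variables (f : {linear M -> M'}) (g : {linear N -> N'}).

Fact tens_map_bilin : bilin (fun m n => tens (f m) (g n)).
Proof.
by split=> *; rewrite ?linearD ?linearZ_LR ?tensDl ?tensDr ?tensZl ?tensZr.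
Qed.

Definition tens_map : tensor M N -> tensor M' N' := tens_lift tens_map_bilin.
HB.instance Definition _ :=
  GRing.Linear.copy tens_map (tens_lift tens_map_bilin).

Lemma tens_mapE m n : tens_map (tens m n) = tens (f m) (g n).
Proof. exact: tens_liftE. Qed.
End TensorMap.

Section TensorMul.
Variables (A : comPzRingType).
Fact tens_mul_bilin : bilin (fun x y : A^o => x * y : A^o).
Proof.
split=> [||a x y|a x y]; first exact: mulrDl.
- exact: mulrDr.
- exact: esym (mulrA a x y).
- exact: mulrCA x a y.
Qed.
(* The canonical isomorphism from A (x) A to A. *)
Definition tens_mul : tensor A^o A^o -> A^o := tens_lift tens_mul_bilin.
HB.instance Definition _ := GRing.Linear.copy tens_mul (tens_lift tens_mul_bilin).
End TensorMul.

Section Away.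
Variables (A : comPzRingType) (s : A).

(* The pair (x, n) stands for the fraction x / s ^+ n. *)
Definition away_eq : rel (A * nat) :=
  fun u v => `[< exists k, s ^+ (k + v.2) * u.1 = s ^+ (k + u.2) * v.1 >].

Lemma away_aux c a b (x y : A) :
  s ^+ a * x = s ^+ b * y -> s ^+ (c + a) * x = s ^+ (c + b) * y.
Proof. by move=> h; rewrite !exprD -!mulrA h. Qed.

Fact away_eq_refl : reflexive away_eq.
Proof. by move=> u; apply/asboolP; exists 0. Qed.
Fact away_eq_sym : symmetric away_eq.
Proof. by move=> u v; apply/asboolP/asboolP => -[k e]; exists k. Qed.
Fact away_eq_trans : transitive away_eq.
Proof.
move=> [y m] [x n] [z l] /asboolP[/= k e] /asboolP[/= k' e'].
apply/asboolP; exists (k + k' + m)%N => /=.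
rewrite (_ : (k + k' + m + l = (k' + l) + (k + m))%N); last by lia.
rewrite (away_aux _ e) (_ : (k' + l + (k + n) = (k + n) + (k' + l))%N); last by lia.
by rewrite (away_aux _ e'); congr (s ^+ _ * _); lia.
Qed.

Canonical away_equiv := EquivRel away_eq away_eq_refl away_eq_sym away_eq_trans.

Definition away : Type := {eq_quot away_eq}.
HB.instance Definition _ := Choice.on away.
HB.instance Definition _ := Quotient.on away.

Lemma away_piP (u v : A * nat) : (\pi_away u = \pi_away v) <->
  exists k, s ^+ (k + v.2) * u.1 = s ^+ (k + u.2) * v.1.
Proof.
split=> [/eqP|h]; first by rewrite piE => /asboolP.
by apply/eqP; rewrite piE; apply/asboolP.
Qed.

Lemma away_repr u :
  exists k, s ^+ (k + u.2) * (repr (\pi_away u)).1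
          = s ^+ (k + (repr (\pi_away u)).2) * u.1.
Proof. by apply/away_piP; rewrite reprK. Qed.

Definition frac_add (u v : A * nat) : A * nat :=
  (s ^+ v.2 * u.1 + s ^+ u.2 * v.1, (u.2 + v.2)%N).
Definition frac_mul (u v : A * nat) : A * nat := (u.1 * v.1, (u.2 + v.2)%N).

Definition away_zero : away := \pi_away (0, 0%N).
Definition away_one : away := \pi_away (1, 0%N).
Definition away_opp (x : away) : away := \pi_away (- (repr x).1, (repr x).2).
Definition away_add (x y : away) : away := \pi_away (frac_add (repr x) (repr y)).
Definition away_mul (x y : away) : away := \pi_away (frac_mul (repr x) (repr y)).

Lemma away_oppE x n : away_opp (\pi_away (x, n)) = \pi_away (- x, n).
Proof.
apply/away_piP; have [k /= e] := away_repr (x, n).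
by exists k; rewrite /= !mulrN e.
Qed.

Lemma away_addE u v : away_add (\pi_away u) (\pi_away v) = \pi_away (frac_add u v).
Proof.
apply/away_piP; have [k e] := away_repr u; have [l f] := away_repr v.
move: (repr (\pi_away u)) (repr (\pi_away v)) e f.
case: u v => [x n] [y m] [x' n'] [y' m'] /= e f.
exists (k + l)%N; rewrite /= !mulrDr !mulrA -!exprD; congr (_ + _).
  rewrite (_ : (k + l + (n + m) + m' = (l + m + m') + (k + n))%N); last by lia.
  by rewrite (away_aux _ e); congr (s ^+ _ * _); lia.
rewrite (_ : (k + l + (n + m) + n' = (k + n + n') + (l + m))%N); last by lia.
by rewrite (away_aux _ f); congr (s ^+ _ * _); lia.
Qed.

Lemma away_mulE u v : away_mul (\pi_away u) (\pi_away v) = \pi_away (frac_mul u v).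
Proof.
apply/away_piP; have [k e] := away_repr u; have [l f] := away_repr v.
move: (repr (\pi_away u)) (repr (\pi_away v)) e f.
case: u v => [x n] [y m] [x' n'] [y' m'] /= e f.
exists (k + l)%N; rewrite /=.
rewrite (_ : (k + l + (n + m) = (k + n) + (l + m))%N); last by lia.
rewrite (_ : (k + l + (n' + m') = (k + n') + (l + m'))%N); last by lia.
by rewrite (exprD s (k + n)) (exprD s (k + n')) mulrACA e f mulrACA.
Qed.

Lemma away_ind (P : away -> Prop) :
  (forall x n, P (\pi_away (x, n))) -> forall z, P z.
Proof. by move=> h z; rewrite -[z]reprK; case: (repr z). Qed.

Fact away_addA : associative away_add.
Proof.
elim/away_ind=> x n; elim/away_ind=> y m; elim/away_ind=> z l.
rewrite (away_addE (y, m)) (away_addE (x, n) (y, m)) !away_addE.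
congr (\pi_away _); rewrite /frac_add /= addnA; congr (_, _).
rewrite !mulrDr !mulrA -!exprD addrA [(m + l)%N]addnC.
by congr (_ + _ + s ^+ _ * _); rewrite [(l + n)%N]addnC.
Qed.
Fact away_addC : commutative away_add.
Proof.
elim/away_ind=> x n; elim/away_ind=> y m; rewrite !away_addE.
by congr (\pi_away _); rewrite /frac_add /= addrC addnC.
Qed.
Fact away_add0 : left_id away_zero away_add.
Proof.
elim/away_ind=> x n; rewrite away_addE.
by congr (\pi_away _); rewrite /frac_add /= mulr0 add0r mul1r.
Qed.
Fact away_addN : left_inverse away_zero away_opp away_add.
Proof.
elim/away_ind=> x n; rewrite away_oppE away_addE; apply/away_piP; exists 0%N.
by rewrite /= mulrN addNr !mulr0.
Qed.
HB.instance Definition _ :=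
  GRing.isZmodule.Build away away_addA away_addC away_add0 away_addN.

Fact away_mulA : associative away_mul.
Proof.
elim/away_ind=> x n; elim/away_ind=> y m; elim/away_ind=> z l.
rewrite (away_mulE (y, m)) (away_mulE (x, n) (y, m)) !away_mulE.
by rewrite /frac_mul /= mulrA addnA.
Qed.
Fact away_mulC : commutative away_mul.
Proof.
elim/away_ind=> x n; elim/away_ind=> y m; rewrite !away_mulE.
by rewrite /frac_mul /= mulrC addnC.
Qed.
Fact away_mul1 : left_id away_one away_mul.
Proof. by elim/away_ind=> x n; rewrite away_mulE /frac_mul /= mul1r. Qed.
Fact away_mulDl : left_distributive away_mul +%R.
Proof.
elim/away_ind=> x n; elim/away_ind=> y m; elim/away_ind=> z l.
rewrite [_ + _ in LHS](away_addE (x, n)) (away_mulE (x, n)) (away_mulE (y, m)).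
rewrite [_ + _ in RHS]away_addE (away_mulE (frac_add _ _)).
apply/away_piP; exists 0%N; rewrite /= !add0n !mulrDl !mulrDr !mulrA -!exprD.
by congr (_ + _); congr (s ^+ _ * _ * _); lia.
Qed.
HB.instance Definition _ := GRing.Zmodule_isComPzRing.Build away
  away_mulA away_mulC away_mul1 away_mulDl.

Definition away_in (x : A) : away := \pi_away (x, 0%N).
Fact away_in_zmod : zmod_morphism away_in.
Proof.
move=> x y; rewrite [- _ in RHS]away_oppE [_ + _ in RHS]away_addE /frac_add /=.
by rewrite !mul1r.
Qed.
Fact away_in_monoid : monoid_morphism away_in.
Proof. by split=> // x y; rewrite [_ * _ in RHS]away_mulE. Qed.
HB.instance Definition _ :=
  GRing.isZmodMorphism.Build A away away_in away_in_zmod.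
HB.instance Definition _ :=
  GRing.isMonoidMorphism.Build A away away_in away_in_monoid.

Definition away_scale (a : A) (z : away) : away := away_in a * z.
Fact away_scaleA a b z : away_scale a (away_scale b z) = away_scale (a * b) z.
Proof. by rewrite /away_scale rmorphM mulrA. Qed.
Fact away_scale1 : left_id 1 away_scale.
Proof. by move=> z; rewrite /away_scale rmorph1 mul1r. Qed.
Fact away_scaleDr : right_distributive away_scale +%R.
Proof. by move=> a z t; rewrite /away_scale mulrDr. Qed.
Fact away_scaleDl z : {morph away_scale^~ z : a b / a + b}.
Proof. by move=> a b; rewrite /away_scale rmorphD mulrDl. Qed.
HB.instance Definition _ := GRing.Zmodule_isLmodule.Build A away
  away_scaleA away_scale1 away_scaleDr away_scaleDl.

(* The localization map as an A-linear map. *)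
Definition away_map (x : A^o) : away := away_in x.
Fact away_map_linear : linear away_map.
Proof. by move=> a x y; rewrite /away_map rmorphD rmorphM. Qed.
HB.instance Definition _ :=
  GRing.isLinear.Build A A^o away *:%R away_map away_map_linear.

End Away.

Section Complexes.
Variable A : comPzRingType.

(* Differentials are indexed by both endpoints, and vanish unless j = i + 1;
   this avoids transporting along equalities of degrees. *)
Record cochain := Cochain {
  cc_obj :> int -> lmodType A;
  cc_d : forall i j, {linear cc_obj i -> cc_obj j};
  cc_shape : forall i j, i + 1 != j -> forall x, cc_d i j x = 0;
  cc_dd : forall i j k x, cc_d j k (cc_d i j x) = 0
}.

Record chain_map (C D : cochain) := ChainMap {
  cm_fun :> forall i, {linear C i -> D i};
  cm_comm : forall i j x, cm_fun j (cc_d C i j x) = cc_d D i j (cm_fun i x)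
}.

(* H^i(C) = Ker(d : C^i -> C^{i+1}) / Im(d : C^{i-1} -> C^i). *)
Section Cohomology.
Variables (C : cochain) (i : int).

Definition cocycle : lmodType A := lker (cc_d C i (i + 1)).

Definition bound_pred : {pred cocycle} :=
  fun z => lker_val z \in limg_pred (cc_d C (i - 1) i).
Fact bound_closed : submod_closed bound_pred.
Proof.
split=> [|a x y hx hy]; rewrite unfold_in /bound_pred.
  by rewrite -[lker_val _]/(val _) raddf0 rpred0.
by rewrite -[lker_val _]/(val _) linearP rpredD // rpredZ.
Qed.
HB.instance Definition _ :=
  GRing.isSubmodClosed.Build A cocycle bound_pred bound_closed.

Definition cohomology : lmodType A := modquot bound_pred.
End Cohomology.

Section CohomologyMap.
Variables (C D : cochain) (f : chain_map C D) (i : int).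

Fact coh_cocycle (z : cocycle C i) : f i (lker_val z) \in lker_pred (cc_d D i (i + 1)).
Proof.
case: z => z hz /=; rewrite unfold_in /lker_pred -cm_comm.
by move: hz; rewrite unfold_in => /eqP ->; rewrite linear0.
Qed.
Definition cocycle_map (z : cocycle C i) : cocycle D i := LKer (coh_cocycle z).
Fact cocycle_map_linear : linear cocycle_map.
Proof. by move=> a x y; apply: val_inj; rewrite /= linearP. Qed.
HB.instance Definition _ := GRing.isLinear.Build A (cocycle C i) (cocycle D i)
  *:%R cocycle_map cocycle_map_linear.

Fact coh_bound (z : cocycle C i) :
  z \in @bound_pred C i -> (@mq_proj _ _ (@bound_pred D i) \o cocycle_map) z = 0.
Proof.
move=> /asboolP[x hx]; rewrite -(raddf0 (@mq_proj _ _ (@bound_pred D i))).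
apply: mq_pi_eq; rewrite subr0; apply/asboolP; exists (f (i - 1) x).
by rewrite -cm_comm hx.
Qed.

Definition cohomology_map : {linear cohomology C i -> cohomology D i} :=
  mq_lift coh_bound.
End CohomologyMap.

Definition quasi_iso (C D : cochain) (f : chain_map C D) :=
  forall i, bijective (cohomology_map f i).

Definition acyclic (C : cochain) := forall i (x : cohomology C i), x = 0.

Definition null_homotopic (C D : cochain) (f : chain_map C D) :=
  exists h : forall i j, {linear C i -> D j}, forall i x,
    f i x = cc_d D (i - 1) i (h i (i - 1) x) + h (i + 1) i (cc_d C i (i + 1) x).

(* Every chain map to an acyclic complex is null-homotopic; equivalently
   (applying this to the shifts of N) Hom(P, N) is acyclic for all acyclic N. *)
Definition K_projective (P : cochain) :=
  forall (N : cochain) (f : chain_map P N), acyclic N -> null_homotopic f.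

Definition conc0_obj (M : lmodType A) (i : int) : lmodType A :=
  if i is Posz 0 then M else 'rV[A]_0.

Definition conc0 (M : lmodType A) : cochain :=
  @Cochain (conc0_obj M) (fun i j => \0) (fun i j _ x => erefl)
    (fun i j k x => erefl).

Section FromConc0.
Variables (M : lmodType A) (D : cochain) (f : {linear M -> D 0}).
Hypothesis f_cocycle : forall x, cc_d D 0 1 (f x) = 0.

Definition from_conc0_fun (i : int) : {linear conc0 M i -> D i} :=
  match i return {linear conc0_obj M i -> D i} with
  | Posz 0 => f | Posz n.+1 => \0 | Negz n => \0 end.

Fact from_conc0_comm i j x :
  from_conc0_fun j (cc_d (conc0 M) i j x) = cc_d D i j (from_conc0_fun i x).
Proof.
rewrite linear0; case: i x => [[|n]|n] x /=; rewrite ?linear0 //.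
have [<-|h] := eqVneq (0 + 1) j; first by rewrite f_cocycle.
by rewrite cc_shape.
Qed.

Definition from_conc0 : chain_map (conc0 M) D := ChainMap from_conc0_comm.
End FromConc0.

Section HomComplex.
Variables (P : cochain) (N : lmodType A).

Definition precomp (M M' : lmodType A) (c : A) (d : {linear M -> M'})
  (f : lhom M' N) : lhom M N := c *: (f \o d : lhom M N).
Fact precomp_linear M M' c d : linear (@precomp M M' c d).
Proof.
move=> a f g; apply: lhomP => x; rewrite /precomp /=.
by rewrite scalerDr !scalerA mulrC.
Qed.
HB.instance Definition _ M M' c d := GRing.isLinear.Build A (lhom M' N)
  (lhom M N) *:%R (@precomp M M' c d) (@precomp_linear M M' c d).

(* The complex Hom(P, N) with N in degree 0: in degree i it is Hom(P^{-i}, N),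
   with the usual sign d(f) = - (-1)^i f o d_P. *)
Definition hom_obj (i : int) : lmodType A := lhom (P (- i)) N.
Definition hom_d (i j : int) : {linear hom_obj i -> hom_obj j} :=
  precomp ((-1) ^+ `|i|.+1) (cc_d P (- j) (- i)).

Fact hom_shape i j : i + 1 != j -> forall f, hom_d i j f = 0.
Proof.
move=> h f; apply: lhomP => x; rewrite /= /precomp /= cc_shape ?linear0 ?scaler0 //.
by apply: contraNneq h => h; apply/eqP; lia.
Qed.
Fact hom_dd i j k f : hom_d j k (hom_d i j f) = 0.
Proof. by apply: lhomP => x; rewrite /= /precomp /= cc_dd linear0 !scaler0. Qed.

Definition hom_complex : cochain := Cochain hom_shape hom_dd.
End HomComplex.

(* A two-term complex E0 -> E1; its position is specified when it is used. *)
Record two_term := TwoTerm {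
  tt0 : lmodType A; tt1 : lmodType A; tt_d : {linear tt0 -> tt1} }.

Record tt_map (E F : two_term) := TTMap {
  ttm0 : {linear tt0 E -> tt0 F};
  ttm1 : {linear tt1 E -> tt1 F};
  ttm_comm : forall x, ttm1 (tt_d E x) = tt_d F (ttm0 x) }.

(* The identity C^i -> C^j if i = j, and 0 otherwise. *)
Definition cc_cast (C : int -> lmodType A) (i j : int) : {linear C i -> C j} :=
  match i =P j with
  | ReflectT e => match e in _ = k return {linear C i -> C k} with
                  | erefl => idfun end
  | ReflectF _ => \0
  end.

Lemma cc_cast_id (C : int -> lmodType A) i (x : C i) : cc_cast C i i x = x.
Proof.
by rewrite /cc_cast; case: eqP => // e; rewrite (eq_irrelevance e erefl).
Qed.
Lemma cc_cast_neq (C : int -> lmodType A) i j x : i != j -> cc_cast C i j x = 0.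
Proof. by rewrite /cc_cast; case: eqP. Qed.

Section TensTT.
Variables (k : int) (E : two_term) (C : cochain).

(* E (x) C where E0 -> E1 sits in degrees k and k + 1; the differential is
   d(e (x) c) = d(e) (x) c + (-1)^|e| e (x) d(c). *)
Definition ttens_obj (q : int) : lmodType A :=
  (tensor (tt0 E) (C (q - k)) * tensor (tt1 E) (C (q - (k + 1))))%type.

Definition ttens_d_fun (q r : int) (u : ttens_obj q) : ttens_obj r :=
  ((-1) ^+ `|k|%N *: tens_map idfun (cc_d C (q - k) (r - k)) u.1,
   tens_map (tt_d E) (cc_cast C (q - k) (r - (k + 1))) u.1
   + (-1) ^+ `|(k + 1)%R|%N *:
       tens_map idfun (cc_d C (q - (k + 1)) (r - (k + 1))) u.2).
Fact ttens_d_linear q r : linear (@ttens_d_fun q r).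
Proof.
move=> a u v; rewrite /ttens_d_fun; congr (_, _) => /=.
  by rewrite linearP scalerDr !scalerA mulrC.
rewrite !linearP /=.
by rewrite addrACA scalerDr.
Qed.
HB.instance Definition _ q r := GRing.isLinear.Build A (ttens_obj q)
  (ttens_obj r) *:%R (@ttens_d_fun q r) (@ttens_d_linear q r).
Definition ttens_d q r : {linear ttens_obj q -> ttens_obj r} := @ttens_d_fun q r.


Lemma cc_cast_d (q r q' r' : int) x : q + 1 = r -> q' + 1 = r' -> q = q' ->
  cc_cast C r r' (cc_d C q r x) = cc_d C q' r' (cc_cast C q q' x).
Proof. by move=> <- <- <-; rewrite !cc_cast_id. Qed.

Fact ttens_shape (q r : int) : q + 1 != r -> forall u, ttens_d q r u = 0.
Proof.
have tm0 (M N M' N' : lmodType A) (f : {linear M -> M'}) (g : {linear N -> N'}) x :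
    (forall y, g y = 0) -> tens_map f g x = 0.
  move=> g0; apply: (@tens_hom_ext _ _ _ _ (tens_map f g) \0) => m n /=.
  by rewrite tens_mapE g0 -(scale0r 0) tensZr scale0r.
move=> h u; rewrite /ttens_d /= /ttens_d_fun; congr (_, _).
  by rewrite tm0 ?scaler0 // => y; rewrite cc_shape //; apply: contraNneq h; lia.
rewrite !tm0 ?scaler0 ?addr0 // => y.
  by rewrite cc_shape //; apply: contraNneq h; lia.
by rewrite cc_cast_neq //; apply: contraNneq h; lia.
Qed.
Fact ttens_dd (q r t : int) u : ttens_d r t (ttens_d q r u) = 0.
Proof.
have [e|h] := eqVneq (q + 1) r; last by rewrite (ttens_shape h) linear0.
have [e'|h] := eqVneq (r + 1) t; last by rewrite (ttens_shape h).
have tm0 (M N N' N'' : lmodType A) (f : {linear N -> N'}) (g : {linear N' -> N''}) :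
    (forall y, g (f y) = 0) -> forall x : tensor M N,
    tens_map idfun g (tens_map idfun f x) = 0.
  move=> h x; apply: (@tens_hom_ext _ _ _ _ (tens_map idfun g \o tens_map idfun f) \0).
  by move=> m n /=; rewrite !tens_mapE /= h -(scale0r 0) tensZr scale0r.
rewrite /ttens_d /= /ttens_d_fun /=; congr (_, _).
  by rewrite linearZ_LR /= tm0 ?scaler0 // => y; rewrite cc_dd.
rewrite !linearD !linearZ_LR /= tm0 ?scaler0 ?addr0; last by move=> y; rewrite cc_dd.
apply/eqP; rewrite addr_eq0 -scaleNr; apply/eqP.
have -> : - (-1) ^+ `|(k + 1)%R|%N = (-1) ^+ `|k|%N :> A.
  rewrite -[in LHS]signr_odd -[in RHS]signr_odd.
  have -> : odd `|(k + 1)%R| = ~~ odd `|k| by lia.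
  by rewrite signrN opprK.
congr (_ *: _); move: u.1 => {}u.
apply: (@tens_hom_ext _ _ _ _
  (tens_map (tt_d E) (cc_cast C _ _) \o tens_map idfun (cc_d C _ _))
  (tens_map idfun (cc_d C _ _) \o tens_map (tt_d E) (cc_cast C _ _))) => m n /=.
by rewrite !tens_mapE /= (cc_cast_d (q' := r - (k + 1))) //; lia.
Qed.

Definition ttens : cochain := Cochain ttens_shape ttens_dd.
End TensTT.

Section TensTTMap.
Variables (k : int) (E F : two_term) (g : tt_map E F).
Variables (C D : cochain) (f : chain_map C D).

Definition ttens_map_fun (q : int) (u : ttens k E C q) : ttens k F D q :=
  (tens_map (ttm0 g) (f (q - k)) u.1, tens_map (ttm1 g) (f (q - (k + 1))) u.2).
Fact ttens_map_linear q : linear (@ttens_map_fun q).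
Proof. by move=> a u v; congr (_, _); rewrite /= linearP. Qed.
HB.instance Definition _ q := GRing.isLinear.Build A (ttens k E C q)
  (ttens k F D q) *:%R (@ttens_map_fun q) (@ttens_map_linear q).

Lemma cc_cast_map (i j : int) x : f j (cc_cast C i j x) = cc_cast D i j (f i x).
Proof.
by have [<-|h] := eqVneq i j; rewrite ?cc_cast_id // !cc_cast_neq ?linear0.
Qed.

Fact ttens_map_comm (q r : int) u :
  ttens_map_fun (cc_d (ttens k E C) q r u)
  = cc_d (ttens k F D) q r (ttens_map_fun u).
Proof.
have tmC (M1 M2 M3 M4 N1 N2 N3 N4 : lmodType A) (p : {linear M1 -> M2})
  (p' : {linear N1 -> N2}) (p2 : {linear M2 -> M4}) (p2' : {linear N2 -> N4})
  (h : {linear M1 -> M3}) (h' : {linear N1 -> N3}) (h2 : {linear M3 -> M4})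
  (h2' : {linear N3 -> N4}) : (forall x, p2 (p x) = h2 (h x)) ->
  (forall x, p2' (p' x) = h2' (h' x)) ->
  forall x, tens_map p2 p2' (tens_map p p' x) = tens_map h2 h2' (tens_map h h' x).
  move=> e e' x; apply: (@tens_hom_ext _ _ _ _
    (tens_map p2 p2' \o tens_map p p') (tens_map h2 h2' \o tens_map h h')).
  by move=> m n /=; rewrite !tens_mapE e e'.
rewrite /= /ttens_d_fun /ttens_map_fun /=; congr (_, _).
  by rewrite linearZ_LR; congr (_ *: _); apply: tmC => // y; rewrite cm_comm.
rewrite linearD linearZ_LR; congr (_ + _ *: _); apply: tmC => //= y.
- exact: ttm_comm.
- exact: cc_cast_map.
- exact: cm_comm.
Qed.

Definition ttens_map : chain_map (ttens k E C) (ttens k F D) :=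
  ChainMap ttens_map_comm.
End TensTTMap.

Definition mulby (a : A) (x : A^o) : A^o := a * x.
Fact mulby_linear a : linear (mulby a).
Proof. by move=> b x y; rewrite /mulby mulrDr; congr (_ + _); apply: mulrCA. Qed.
HB.instance Definition _ a :=
  GRing.isLinear.Build A A^o A^o *:%R (mulby a) (mulby_linear a).

(* K(A; a) = K(A; a_1) (x) (K(A; a_2) (x) ( ... (x) A)), where K(A; a_1) is
   a_1 : A -> A in degrees -1 and 0. *)
Fixpoint koszul (s : seq A) : cochain :=
  if s is a :: s' then ttens (-1) (TwoTerm (mulby a)) (koszul s')
  else conc0 A^o.

Section Mu.
Variables (i j : nat) (hij : (i <= j)%N).

Fact koszul_mu1_comm a (x : A^o) :
  idfun (mulby (a ^+ j) x) = mulby (a ^+ i) (mulby (a ^+ (j - i)) x).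
Proof. by rewrite /mulby /= mulrA -exprD subnKC. Qed.

Definition koszul_mu1 (a : A) :
  tt_map (TwoTerm (mulby (a ^+ j))) (TwoTerm (mulby (a ^+ i))) :=
  @TTMap (TwoTerm (mulby (a ^+ j))) (TwoTerm (mulby (a ^+ i)))
    (mulby (a ^+ (j - i))) idfun (koszul_mu1_comm a).

Definition cm_id (C : cochain) : chain_map C C :=
  @ChainMap C C (fun=> idfun) (fun _ _ _ => erefl).

Fixpoint koszul_mu (s : seq A) :
    chain_map (koszul [seq a ^+ j | a <- s]) (koszul [seq a ^+ i | a <- s]) :=
  match s with
  | [::] => cm_id _
  | a :: s' => ttens_map (-1) (koszul_mu1 a) (koszul_mu s')
  end.
End Mu.

Definition pro_zero (N : nat -> lmodType A)
    (t : forall i j, (i <= j)%N -> {linear N j -> N i}) :=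
  forall i, exists j, exists hij : (i <= j)%N, forall x, t i j hij x = 0.

Definition weakly_proregular (s : seq A) :=
  forall q : int, q < 0 ->
    pro_zero (fun i j hij => cohomology_map (@koszul_mu i j hij s) q).

Definition dual_koszul1 (a : A) : two_term := TwoTerm (@away_map A a).

Fixpoint dual_koszul (s : seq A) : cochain :=
  if s is a :: s' then ttens 0 (dual_koszul1 a) (dual_koszul s')
  else conc0 A^o.

(* The degree 0 component of the dual Koszul complex is A (x) ( ... (x) A), up
   to zero summands; the augmentation identifies it with A by multiplication. *)
Section AugStep.
Variables (E1 : lmodType A) (C : cochain) (e : {linear C 0 -> A^o}).
Variable d : {linear A^o -> E1}.
Definition aug_step (u : ttens 0 (TwoTerm d) C 0) : A^o :=
  tens_mul (tens_map idfun e u.1).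
Fact aug_step_linear : linear aug_step.
Proof. by move=> a u v; rewrite /aug_step -!linearP. Qed.
HB.instance Definition _ := GRing.isLinear.Build A
  (ttens 0 (TwoTerm d) C 0) A^o *:%R aug_step aug_step_linear.
End AugStep.

Fixpoint augmentation (s : seq A) : {linear dual_koszul s 0 -> A^o} :=
  match s return {linear dual_koszul s 0 -> A^o} with
  | [::] => idfun
  | a :: s' => @aug_step _ _ (augmentation s') (@away_map A a)
  end.

Lemma dual_koszul_neg s (i : int) (x : dual_koszul s i) : i < 0 -> x = 0.
Proof.
have t0 (M N : lmodType A) : (forall y : N, y = 0) -> forall z : tensor M N, z = 0.
  move=> h z; apply: (@tens_hom_ext _ _ _ _ idfun \0) => m n /=.
  by rewrite (h n) -(scale0r 0) tensZr scale0r.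
elim: s i x => [|a s ih] i x hi.
  by case: i x hi => // n x _; apply: thinmx0.
by case: x => x y; congr (_, _); apply: t0 => z; apply: ih; lia.
Qed.

Section DerivedComplete.
Variables (s : seq A) (P : cochain) (rho : chain_map P (dual_koszul s)).

Definition aug_res : lhom (P 0) A^o := augmentation s \o rho 0.

Definition to_hom0 (a : A^o) : hom_complex P A^o 0 := (a : A) *: aug_res.
Fact to_hom0_linear : linear to_hom0.
Proof. by move=> a x y; rewrite /to_hom0 scalerDl scalerA. Qed.
HB.instance Definition _ := GRing.isLinear.Build A A^o
  (hom_complex P A^o 0) *:%R to_hom0 to_hom0_linear.

Fact to_hom0_cocycle a : cc_d (hom_complex P A^o) 0 1 (to_hom0 a) = 0.
Proof.
apply: lhomP => x /=; rewrite /precomp /= cm_comm.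
by rewrite [rho _ x]dual_koszul_neg // !linear0.
Qed.

(* A -> Hom(P, A), a |-> a * (aug o rho): for a K-projective resolution rho, this
   is the morphism A -> RHom(K, A) induced by the augmentation. *)
Definition to_rhom : chain_map (conc0 A^o) (hom_complex P A^o) :=
  from_conc0 to_hom0_cocycle.
End DerivedComplete.

(* RHom(K, A) is computed as Hom(P, A) for a K-projective resolution P -> K;
   such resolutions exist and are unique up to homotopy equivalence. *)
Definition seq_derived_complete (s : seq A) :=
  exists (P : cochain) (rho : chain_map P (dual_koszul s)),
    [/\ K_projective P, quasi_iso rho & quasi_iso (to_rhom rho)].

End Complexes.

Local Open Scope classical_set_scope.

Definition ideal_span (A : comPzRingType) (S : set A) : set A :=
  [set x | exists2 s : seq (A * A), (forall u, u \in s -> S u.2) &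
    x = \sum_(u <- s) u.1 * u.2].

Section Ideals.
Variable A : comPzRingType.

Definition ideal_add (J K : set A) : set A :=
  [set x : A | exists y z : A, [/\ J y, K z & x = y + z]].

Definition weakly_proregular_ideal (J : set A) :=
  exists s : seq A, J = ideal_span [set` s] /\ weakly_proregular s.

Definition derived_complete_ideal (J : set A) :=
  exists s : seq A, J = ideal_span [set` s] /\ seq_derived_complete s.

(* Ideals of A are submodules of the regular module A^o. *)
Definition ideal_set (I : submodClosed A^o) : set A := [set x : A | x \in I].

(* A_t (x) I, seen inside A_t, is the ideal of A_t generated by the image of I. *)
Definition effective_Cartier (I : submodClosed A^o) :=
  exists s : seq A, ideal_span [set` s] = setT /\
    forall t, t \in s -> exists d : away t,
      GRing.lreg d /\ ideal_span (@away_in A t @` ideal_set I) = ideal_span [set d].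

Definition bounded_torsion (M : zmodType) (p : nat) :=
  exists j0 : nat, forall j, (j0 <= j)%N ->
    [set x : M | x *+ (p ^ j) = 0] = [set x | x *+ (p ^ j0) = 0].
End Ideals.

Section Delta.
Variables (p : nat) (A : comPzRingType) (delta : A -> A).

(* The last summand is (x^p + y^p - (x + y)^p) / p, read as the polynomial with
   integer coefficients that it is (A may have p-torsion). *)
Definition delta_structure :=
  [/\ delta 0 = 0, delta 1 = 0,
    forall x y, delta (x * y) =
      x ^+ p * delta y + y ^+ p * delta x + p%:R * delta x * delta y &
    forall x y, delta (x + y) = delta x + delta y
      - \sum_(1 <= i < p) ('C(p, i) %/ p)%:R * x ^+ i * y ^+ (p - i)].

Definition frobenius_lift (x : A) : A := x ^+ p + p%:R * delta x.
End Delta.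

Record padic_prism (p : nat) := PadicPrism {
  prism_ring :> comPzRingType;
  prism_str : {rmorphism Zlocal p -> prism_ring};
  prism_ideal : submodClosed prism_ring^o;
  prism_delta : prism_ring -> prism_ring;
  prism_Cartier : effective_Cartier prism_ideal;
  prism_complete : derived_complete_ideal
    (ideal_add (ideal_set prism_ideal) (ideal_span [set p%:R]));
  prism_deltaP : delta_structure p prism_delta;
  prism_frobenius : ideal_add (ideal_set prism_ideal)
    (ideal_span (frobenius_lift p prism_delta @` ideal_set prism_ideal)) p%:R
}.

Definition bounded_prism (p : nat) (A : padic_prism p) :=
  bounded_torsion (modquot (prism_ideal A)) p.

(* Main.v *)
(** The ideal I is locally generated by one regular element: there are t_1, ...,
    t_m generating the unit ideal of A and f_k in I such that f_k is regular in
    A[1/t_k] and generates I there. Then I + (p) is generated by f_1, ..., f_m, p,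
    and whether a transition map of Koszul cohomology vanishes can be checked over
    each B = A[1/t_k]. Over B all the f_l are multiples of f = f_k. Elements
    before f in the sequence can be dropped, since f^i kills the cohomology of the
    Koszul complex on the i-th powers; as f is regular, removing f itself amounts
    to working over B / f^i; there the transition maps kill the part coming from
    the other multiples of f, and what is left is the p-power torsion of B / f^i,
    which is bounded because that of A / I is. *)

From HB Require Import structures.
Require Import Defs.
From mathcomp Require Import all_boot all_order all_algebra.
From mathcomp Require Import boolp classical_sets.
From mathcomp Require Import zify ring.

Set Implicit Arguments.
Unset Strict Implicit.
Unset Printing Implicit Defensive.

Import Order.TTheory GRing.Theory Num.Theory.
Local Open Scope classical_set_scope.
Local Open Scope ring_scope.

(** * Koszul complexes without their grading *)

Section Exterior.
Variable R : comPzRingType.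
Implicit Types (s : seq R) (f a b : R) (i j e m n : nat).

(* The Koszul complex on s without its grading: it does not depend on the
   exponent i of the sequence of i-th powers, only the differential [ext_d i]
   does, and [ext_mu (j - i)] is the transition map from exponent j to i. *)
Fixpoint ext s : lmodType R :=
  if s is _ :: s' then (ext s' * ext s')%type else R^o.

Arguments ext : simpl nomatch.

Fixpoint ext_d i s : ext s -> ext s :=
  match s return ext s -> ext s with
  | [::] => fun=> 0
  | a :: s' => fun z => (- ext_d i z.1, a ^+ i *: z.1 + ext_d i z.2)
  end.

Fixpoint ext_mu e s : ext s -> ext s :=
  match s return ext s -> ext s with
  | [::] => id
  | a :: s' => fun z => (a ^+ e *: ext_mu e z.1, ext_mu e z.2)
  end.

(* The component of degree 0. *)
Fixpoint ext_top s : ext s -> R :=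
  match s return ext s -> R with
  | [::] => id
  | _ :: s' => fun z => ext_top z.2
  end.

Fact ext_d_linear i s : linear (@ext_d i s).
Proof.
elim: s => [|a s ih] c x y /=; first by rewrite scaler0 addr0.
congr (_, _); rewrite /= ih; first by rewrite opprD scalerN.
by rewrite !scalerDr !scalerA [a ^+ i * c]mulrC addrACA.
Qed.
HB.instance Definition _ i s := GRing.isLinear.Build R (ext s) (ext s) *:%R
  (@ext_d i s) (@ext_d_linear i s).

Fact ext_mu_linear e s : linear (@ext_mu e s).
Proof.
elim: s => [|a s ih] c x y //=.
by congr (_, _); rewrite /= ih // scalerDr !scalerA [a ^+ e * c]mulrC.
Qed.
HB.instance Definition _ e s := GRing.isLinear.Build R (ext s) (ext s) *:%R
  (@ext_mu e s) (@ext_mu_linear e s).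

Fact ext_top_linear s : linear (@ext_top s : ext s -> R^o).
Proof. by elim: s => [|a s ih] c x y //; exact: ih. Qed.
HB.instance Definition _ s := GRing.isLinear.Build R (ext s) R^o *:%R
  (@ext_top s : ext s -> R^o) (@ext_top_linear s).

Lemma ext_muZ e s c (z : ext s) : ext_mu e (c *: z) = c *: ext_mu e z.
Proof. exact: linearZ_LR. Qed.

Lemma ext_dZ i s c (z : ext s) : ext_d i (c *: z) = c *: ext_d i z.
Proof. exact: linearZ_LR. Qed.

Lemma ext_mu_d i e s (z : ext s) :
  ext_mu e (ext_d (i + e) z) = ext_d i (ext_mu e z).
Proof.
elim: s z => [|a s ih] //= [x y] /=; congr (_, _).
  by rewrite linearN /= ih linearZ_LR scalerN.
by rewrite linearD linearZ_LR /= ih scalerA -exprD.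
Qed.

Lemma ext_dd i s (z : ext s) : ext_d i (ext_d i z) = 0.
Proof.
elim: s z => [|a s ih] //= [x y] /=; congr (_, _) => /=.
  by rewrite linearN /= ih !oppr0.
by rewrite scalerN linearD /= ext_dZ ih addr0 addNr.
Qed.

Lemma ext_muD m n s (z : ext s) : ext_mu m (ext_mu n z) = ext_mu (m + n) z.
Proof.
elim: s z => [|a s ih] //= [x y] /=; congr (_, _) => //.
by rewrite linearZ_LR /= ih scalerA exprD.
Qed.

Lemma ext_top_mu e s (z : ext s) : ext_top (ext_mu e z) = ext_top z.
Proof. by elim: s z => [|a s ih] //= [x y] /=; apply: ih. Qed.

Lemma ext_reg f s (z : ext s) : GRing.lreg f -> f *: z = 0 -> z = 0.
Proof.
move=> fr; elim: s z => [|a s ih] /=; first by move=> z h; apply: fr; rewrite mulr0.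
by case=> x y [hx hy]; rewrite (ih x hx) (ih y hy).
Qed.


(** Exterior multiplication by the generator belonging to an occurrence of [f] is a homotopy from
    multiplication by [f ^+ i] to 0. It lowers the degree by one, so its values have no component of
    degree 0. *)
Lemma ext_homotopy f i s : f \in s -> exists h : ext s -> ext s,
  [/\ linear h, forall z, ext_d i (h z) + h (ext_d i z) = f ^+ i *: z
    & forall z, ext_top (h z) = 0].
Proof.
elim: s => [|a s ih] //=; rewrite inE => /predU1P[<-|/ih [h [hlin hd ht]]].
  exists (fun z => (z.2, 0)); split=> [c x y|[x y]|z] /=; last exact: linear0.
    by congr (_, _); rewrite /= scaler0 addr0.
  congr (_, _) => /=; first by rewrite addrCA addNr addr0.
  by rewrite linear0 !addr0.
have hN z : h (- z) = - h z by exact: (linearN (lhom_mk hlin)).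
exists (fun z => (- h z.1, h z.2)); split=> [c x y|[x y]|z] /=; last exact: ht.
  by congr (_, _); rewrite /= hlin // opprD scalerN.
congr (_, _) => /=.
  by rewrite linearN opprK hN -hd opprK.
by rewrite scalerN hlin addrACA addNr add0r hd.
Qed.

Lemma ext_coboundary f i s (z : ext s) : f \in s -> ext_d i z = 0 ->
  exists2 w, ext_d i w = f ^+ i *: z & ext_top w = 0.
Proof.
move=> /(ext_homotopy i)[h [hlin hd ht]] dz; exists (h z); last exact: ht.
by rewrite -hd dz -[h 0]/(lhom_mk hlin 0) linear0 addr0.
Qed.

(* Vanishing of the degree 0 component replaces the restriction to negative
   degrees. *)
Definition ext_wpr s := forall i, exists J, forall j, (J + i <= j)%N ->
  forall z : ext s, ext_top z = 0 -> ext_d j z = 0 ->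
    exists w, ext_d i w = ext_mu (j - i) z.

(** For a cocycle [(x, y)] on [b :: s], passing from exponent [j] to [m] multiplies [x] by
    [b ^+ (j - m)], a multiple of [f ^+ m], which makes it a coboundary. Correcting [y] by the
    primitive gives a cocycle on [s], and the transition from [m] to [i] kills that one. *)
Lemma ext_wpr_cons f b s : f \in s -> (exists c, b = c * f) ->
  ext_wpr s -> ext_wpr (b :: s).
Proof.
move=> fs [c bE] ws i; have [J hJ] := ws i; set m := (J + i)%N.
(* One [m] makes [b ^+ (j - m)] divisible by [f ^+ m]; the other is the exponent at which the
   hypothesis on [s] is applied. *)
exists (m + m)%N => j hj [x y] /= ty [dx dy].
have emj u : ext_d m (ext_mu (j - m) u : ext s) = ext_mu (j - m) (ext_d j u).
  by rewrite -ext_mu_d; congr (ext_mu _ (ext_d _ _)); lia.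
move/eqP: dx; rewrite oppr_eq0 => /eqP dx.
have [|w dw tw] := @ext_coboundary f m s (ext_mu (j - m) x) fs.
  by rewrite emj dx linear0.
set g := c ^+ (j - m) * f ^+ (j - m - m).
have bg : b ^+ (j - m) = g * f ^+ m.
  by rewrite /g -mulrA -exprD subnK ?bE ?exprMn //; lia.
have [|||v dv] := hJ m _ (ext_mu (j - m) y + b ^+ m *: (g *: w)) => //.
- by rewrite linearD !linearZ_LR /= ext_top_mu ty tw !scaler0 addr0.
- rewrite linearD !linearZ_LR /= dw [g *: _]scalerA -bg emj scalerA -exprD.
  move/(congr1 (@ext_mu (j - m) s)): dy; rewrite linear0 linearD linearZ_LR /= addrC.
  by move<-; congr (_ + _ *: _); congr (_ ^+ _); lia.
exists (- (b ^+ (m - i) * g *: ext_mu (m - i) w), v).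
have mi : (i + (m - i) = m)%N by lia.
have ji : (m - i + (j - m) = j - i)%N by lia.
congr (_, _) => /=.
  rewrite linearN opprK linearZ_LR /= -ext_mu_d mi dw linearZ_LR /= ext_muD ji.
  by rewrite scalerA -mulrA -bg -exprD ji.
rewrite dv linearD /= !ext_muZ ext_muD ji scalerN !scalerA mulrA -exprD mi.
by rewrite addrC addrK.
Qed.

(** As [f] is regular, [R / f ^+ i] is filtered by [i] copies of [R / f], and each layer costs one
    factor [p ^+ n]. *)
Lemma divides_pow_torsion f p n :
  GRing.lreg f ->
  (forall k u, (exists c, p ^+ k * u = c * f) -> exists c, p ^+ n * u = c * f) ->
  forall i k u, (exists c, p ^+ k * u = c * f ^+ i) ->
    exists c, p ^+ (i * n) * u = c * f ^+ i.
Proof.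
move=> fr bd; elim=> [|i ih] k u [c e].
  by exists u; rewrite mul0n !expr0 mul1r mulr1.
have [|c1 e1] := ih k u; first by exists (c * f); rewrite e exprSr mulrA mulrAC.
have fri : GRing.lreg (f ^+ i) by apply: lregX.
have [|c2 e2] := bd k c1.
  exists (p ^+ (i * n) * c); apply: fri.
  by rewrite mulrCA [f ^+ i * c1]mulrC -e1 mulrCA e exprS; ring.
by exists c2; rewrite mulSn exprD -mulrA e1 mulrA e2 exprS mulrA.
Qed.

(** * Sequences made of a regular [f], multiples of [f], and a last element [p] *)

Section Tail.
Variables (f p : R) (n : nat).
Hypothesis fr : GRing.lreg f.
Hypothesis bd : forall k u, (exists c, p ^+ k * u = c * f) ->
  exists c, p ^+ n * u = c * f.

(* The same condition on s as weak proregularity, but over R / f: x records that y is a cocycle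
   modulo f ^+ j. *)
Lemma ext_wpr_mod s : (forall b, b \in s -> exists c, b = c * f) ->
  forall i, exists J, forall j, (J + i <= j)%N -> forall (y : ext (rcons s p)) x,
    ext_top y = 0 -> ext_d j y = f ^+ j *: x ->
    exists x' y', ext_mu (j - i) y = f ^+ i *: x' + ext_d i y'.
Proof.
elim: s => [|b s ih] sf i.
  (* Only [p] is left: [p ^+ j * u] is a multiple of [f ^+ j], hence of [f ^+ i], and the transition
     map multiplies [u] by [p ^+ (j - i)] with [i * n <= j - i]. *)
  exists (i * n)%N => j hj [u v] [x1 x2] /= v0 [_ e].
  have [|c ec] := divides_pow_torsion fr bd (i := i) (k := j) (u := u).
    exists (x2 * f ^+ (j - i)); rewrite -mulrA -exprD subnK; last by lia.
    by rewrite [RHS]mulrC; move: e; rewrite addr0.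
  exists (p ^+ (j - i - i * n) * c, 0), 0; rewrite linear0 v0.
  congr (_, _); rewrite /= ?scaler0 ?addr0 //.
  rewrite -[LHS]/(_ * _) -[RHS]/(_ * _) mulrCA [f ^+ i * c]mulrC -ec mulrA -exprD.
  by congr (_ ^+ _ * _); lia.
have [c bE] := sf b (mem_head _ _).
have [|J hJ] := ih _ i; first by move=> a sa; apply: sf; rewrite inE sa orbT.
(* The extra [i] makes [b ^+ (j - i)] divisible by [f ^+ i], which disposes of [u]. As [b ^+ j] is a
   multiple of [f ^+ j], [v] is again a cocycle modulo [f ^+ j]. *)
exists (J + i)%N => j hj [u v] [x1 x2] /= v0 [_ e].
have [|||x' [y' e']] := hJ j _ v (x2 - c ^+ j *: u) => //; first by lia.
  by rewrite scalerBr -e bE exprMn scalerA [f ^+ j * _]mulrC addrC addKr.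
exists (c ^+ (j - i) * f ^+ (j - i - i) *: ext_mu (j - i) u, x'), (0, y').
congr (_, _) => /=.
  rewrite linear0 oppr0 addr0 scalerA mulrCA -exprD subnKC; last by lia.
  by rewrite bE exprMn.
by rewrite scaler0 add0r.
Qed.

(** In a cocycle [(x, y)], [y] is a cocycle modulo [f ^+ j], so its image is
    [f ^+ i *: x' + ext_d i y']. Applying [ext_d i] and cancelling the regular [f ^+ i] shows that
    [(x', y')] is a primitive of the image of [(x, y)]. *)
Lemma ext_wpr_head s : (forall b, b \in s -> exists c, b = c * f) ->
  ext_wpr (f :: rcons s p).
Proof.
move=> sf i; have [J hJ] := ext_wpr_mod sf i; exists J => j hj [x y] /= ty [_ dy].
have [|x' [y' e]] := hJ j hj y (- x) ty.
  by apply/eqP; rewrite scalerN -addr_eq0 addrC; apply/eqP.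
have ij : (i + (j - i) = j)%N by lia.
suff ex : ext_d i x' = - (f ^+ (j - i) *: ext_mu (j - i) x).
  by exists (x', y'); congr (_, _); rewrite /= ?ex ?opprK.
apply/eqP; rewrite -subr_eq0; apply/eqP; apply: (@ext_reg (f ^+ i) _ _ (lregX fr)).
move/(congr1 (@ext_d i _)): e; rewrite -ext_mu_d ij.
have -> : ext_d j y = - (f ^+ j *: x) by apply/eqP; rewrite -addr_eq0 addrC dy.
rewrite linearN linearD /= ext_muZ ext_dZ ext_dd addr0 => e.
by rewrite scalerBr -e scalerN scalerA -exprD ij subrr.
Qed.

Lemma ext_wpr_cat s1 s2 : (forall b, b \in s1 ++ s2 -> exists c, b = c * f) ->
  ext_wpr (s1 ++ f :: rcons s2 p).
Proof.
elim: s1 => [|b s1 ih] sf; first exact: ext_wpr_head.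
apply: (@ext_wpr_cons f).
- by rewrite mem_cat mem_head orbT.
- by apply: sf; rewrite mem_head.
- by apply: ih => a sa; apply: sf; rewrite inE sa orbT.
Qed.
End Tail.
End Exterior.

(** * Base change along a localization *)

Section BaseChange.
Variables (A B : comPzRingType) (phi : {rmorphism A -> B}) (t : A).
Hypothesis phi_ker : forall x, phi x = 0 -> exists N, t ^+ N * x = 0.
Hypothesis phi_frac : forall b, exists N x, phi t ^+ N * b = phi x.

Fixpoint ext_base s : ext s -> ext (map phi s) :=
  match s return ext s -> ext (map phi s) with
  | [::] => phi
  | _ :: s' => fun z => (ext_base z.1, ext_base z.2)
  end.

Lemma ext_baseD s (x y : ext s) : ext_base (x + y) = ext_base x + ext_base y.
Proof.
elim: s x y => [|a s ih] x y /=; first exact: rmorphD.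
by congr (_, _); apply: ih.
Qed.

Lemma ext_baseZ s c (x : ext s) : ext_base (c *: x) = phi c *: ext_base x.
Proof.
elim: s x => [|a s ih] x /=; first exact: rmorphM.
by congr (_, _); apply: ih.
Qed.

Lemma ext_baseN s (x : ext s) : ext_base (- x) = - ext_base x.
Proof. by rewrite -scaleN1r ext_baseZ rmorphN1 scaleN1r. Qed.

Lemma ext_base_d i s (x : ext s) : ext_base (ext_d i x) = ext_d i (ext_base x).
Proof.
elim: s x => [|a s ih] x /=; first exact: rmorph0.
congr (_, _); first by rewrite ext_baseN ih.
by rewrite ext_baseD ext_baseZ rmorphXn ih.
Qed.

Lemma ext_base_mu e s (x : ext s) : ext_base (ext_mu e x) = ext_mu e (ext_base x).
Proof.
elim: s x => [|a s ih] x //=; congr (_, _) => //.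
by rewrite ext_baseZ rmorphXn ih.
Qed.

Lemma ext_base_top s (x : ext s) : ext_top (ext_base x) = phi (ext_top x).
Proof. by elim: s x => [|a s ih] x //=; apply: ih. Qed.

Lemma ext_base_ker s (x : ext s) : ext_base x = 0 -> exists N, t ^+ N *: x = 0.
Proof.
elim: s x => [|a s ih] x /=; first exact: phi_ker.
case: x => x y [/ih[N hN] /ih[M hM]]; exists (N + M)%N; congr (_, _) => /=.
  by rewrite addnC exprD -scalerA hN scaler0.
by rewrite exprD -scalerA hM scaler0.
Qed.

Lemma ext_base_frac s (w : ext (map phi s)) :
  exists N x, phi t ^+ N *: w = ext_base x.
Proof.
elim: s w => [|a s ih] w /=; first exact: phi_frac.
case: w => w v; have [N [x hx]] := ih w; have [M [y hy]] := ih v.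
exists (N + M)%N, (t ^+ M *: x, t ^+ N *: y); congr (_, _) => /=.
  by rewrite ext_baseZ -hx rmorphXn scalerA -exprD addnC.
by rewrite ext_baseZ -hy rmorphXn scalerA -exprD.
Qed.

(** A primitive over [B] descends after clearing its denominator and killing the remaining [t]-power
    torsion. The power [N] depends on [z], but the bound [J] does not. *)
Lemma ext_wpr_base s : ext_wpr (map phi s) ->
  forall i, exists J, forall j, (J + i <= j)%N ->
  forall z : ext s, ext_top z = 0 -> ext_d j z = 0 ->
    exists N w, ext_d i w = t ^+ N *: ext_mu (j - i) z.
Proof.
move=> ws i; have [J hJ] := ws i; exists J => j hj z tz dz.
have [||w] := hJ j hj (ext_base z).
- by rewrite ext_base_top tz rmorph0.
- by rewrite -ext_base_d dz -(scale0r z) ext_baseZ rmorph0 scale0r.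
have [N [x hx]] := ext_base_frac w.
move/(congr1 (fun u => phi t ^+ N *: u)).
rewrite -ext_dZ hx -ext_base_d -ext_base_mu -rmorphXn -ext_baseZ => e.
have [|M hM] := @ext_base_ker _ (ext_d i x - t ^+ N *: ext_mu (j - i) z).
  by rewrite ext_baseD ext_baseN -e subrr.
exists (M + N)%N, (t ^+ M *: x); apply/eqP.
by rewrite ext_dZ -subr_eq0 exprD -scalerA -scalerBr hM.
Qed.
End BaseChange.

(** * The canonical isomorphism of [A (x) N] with [N] *)

Section TensorUnit.
Variable A : comPzRingType.

Fact scale_bilin (N : lmodType A) : bilin (fun (a : A^o) (n : N) => (a : A) *: n).
Proof.
split=> [a b n|a m n|a b n|a b n]; first exact: scalerDl.
- exact: scalerDr.
- exact: esym (scalerA a b n).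
- by rewrite !scalerA mulrC.
Qed.

Definition tens_unit (N : lmodType A) : tensor A^o N -> N :=
  tens_lift (@scale_bilin N).
HB.instance Definition _ N := GRing.Linear.copy (@tens_unit N)
  (tens_lift (@scale_bilin N)).

Lemma tens_unitE (N : lmodType A) (a : A) (n : N) :
  tens_unit (tens (a : A^o) n) = a *: n.
Proof. exact: tens_liftE. Qed.

Definition tens1 (N : lmodType A) (n : N) : tensor A^o N := tens (1 : A^o) n.
Fact tens1_linear N : linear (@tens1 N).
Proof. by move=> a x y; rewrite /tens1 tensDr tensZr. Qed.
HB.instance Definition _ N := GRing.isLinear.Build A N (tensor A^o N) *:%R
  (@tens1 N) (@tens1_linear N).

Lemma tens_unitK (N : lmodType A) : cancel (@tens_unit N) (@tens1 N).
Proof.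
move=> x; apply: (@tens_hom_ext _ _ _ _ (@tens1 N \o @tens_unit N) idfun) => a n.
by rewrite /= tens_unitE /tens1 tensZr -tensZl [_ *: _]mulr1.
Qed.

Lemma tens_unit_map (M N : lmodType A) b (f : {linear A^o -> A^o})
    (g : {linear M -> N}) x : (forall a, f a = b * a) ->
  tens_unit (tens_map f g x) = b *: g (tens_unit x).
Proof.
move=> fE; rewrite -[x]tens_unitK; move: (tens_unit x) => {}x.
rewrite /tens1 tens_mapE !tens_unitE scale1r; congr (_ *: _).
by rewrite fE mulr1.
Qed.
End TensorUnit.

(** * Comparison with the graded Koszul complexes *)

Section Comparison.
Variable A : comPzRingType.
Implicit Types (s : seq A) (i j : nat) (q r : int).

Definition ext_of0 q : conc0 A^o q -> A^o :=
  match q return conc0 A^o q -> A^o with Posz 0 => id | _ => fun=> 0 end.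

Definition koszul_of0 q : A^o -> conc0 A^o q :=
  match q return A^o -> conc0 A^o q with Posz 0 => id | _ => fun=> 0 end.

(** The inclusion of the degree [q] part, with the tensor factors [A] stripped off. *)
Fixpoint ext_of i s q : koszul [seq a ^+ i | a <- s] q -> ext s :=
  match s return koszul [seq a ^+ i | a <- s] q -> ext s with
  | [::] => @ext_of0 q
  | _ :: _ => fun u => (ext_of (tens_unit u.1), ext_of (tens_unit u.2))
  end.

(** The projection onto degree [q]: components of other degrees end in the zero cases of
    [koszul_of0]. It is only a left inverse of [ext_of]. *)
Fixpoint koszul_of i s q : ext s -> koszul [seq a ^+ i | a <- s] q :=
  match s return ext s -> koszul [seq a ^+ i | a <- s] q with
  | [::] => @koszul_of0 q
  | _ :: _ => fun z => (tens1 (koszul_of i _ z.1), tens1 (koszul_of i _ z.2))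
  end.

Fact ext_of_linear i s q : linear (@ext_of i s q).
Proof.
elim: s q => [|a s ih] q c x y /=.
  by case: q x y => [[|n]|n] x y /=; rewrite ?scaler0 ?addr0.
by congr (_, _); rewrite /= linearP ih.
Qed.
HB.instance Definition _ i s q := GRing.isLinear.Build A
  (koszul [seq a ^+ i | a <- s] q) (ext s) *:%R
  (@ext_of i s q) (@ext_of_linear i s q).

Fact koszul_of_linear i s q : linear (@koszul_of i s q).
Proof.
elim: s q => [|a s ih] q c x y /=.
  by case: q => [[|n]|n] /=; rewrite ?scaler0 ?addr0.
by congr (_, _); rewrite /= ih linearP.
Qed.
HB.instance Definition _ i s q := GRing.isLinear.Build A (ext s)
  (koszul [seq a ^+ i | a <- s] q) *:%R
  (@koszul_of i s q) (@koszul_of_linear i s q).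

Lemma ext_ofK i s q : cancel (@ext_of i s q) (@koszul_of i s q).
Proof.
elim: s q => [|a s ih] q /=.
  by case: q => [[|n]|n] //= x; rewrite [x]thinmx0.
by case=> x y; congr (_, _); rewrite /= ih tens_unitK.
Qed.

Lemma ext_of_d i s q r (u : koszul [seq a ^+ i | a <- s] q) : q + 1 = r ->
  ext_of (cc_d (koszul [seq a ^+ i | a <- s]) q r u) = ext_d i (ext_of u).
Proof.
elim: s q r u => [|a s ih] q r u e /=; first exact: (linear0 (@ext_of i [::] r)).
congr (_, _) => /=.
  rewrite !linearZ_LR /= (tens_unit_map (b := 1)) => [|x]; last by rewrite mul1r.
  by rewrite scale1r expr1 scaleN1r ih //; lia.
rewrite !linearD /= (tens_unit_map (b := a ^+ i)) // linearZ_LR /=.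
rewrite expr0 scale1r (tens_unit_map (b := 1)) => [|x]; last by rewrite mul1r.
rewrite scale1r ih; last by lia.
congr (_ *: _ + _); move: (tens_unit u.1).
have -> : r - (-1 + 1) = q - -1 by lia.
by move=> x; rewrite cc_cast_id.
Qed.

Lemma koszul_of_d i s q r (w : ext s) : q + 1 = r ->
  koszul_of i r (ext_d i w) = cc_d (koszul [seq a ^+ i | a <- s]) q r (koszul_of i q w).
Proof.
elim: s q r w => [|a s ih] q r w e /=; first exact: (linear0 (@koszul_of i [::] r)).
congr (_, _) => /=.
  rewrite /tens1 tens_mapE expr1 scaleN1r -ih /=; last by lia.
  by rewrite -[LHS]/(tens1 _) !linearN.
rewrite linearD linearZ_LR /= expr0 scale1r /tens1 !tens_mapE /= -ih; last by lia.
rewrite tensDr tensZr -tensZl; congr (tens _ _ + _).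
have -> : r - (-1 + 1) = q - -1 by lia.
by rewrite cc_cast_id.
Qed.

Lemma ext_of_mu i j (hij : (i <= j)%N) s q
    (u : koszul [seq a ^+ j | a <- s] q) :
  ext_of (koszul_mu hij s q u) = ext_mu (j - i) (ext_of u).
Proof.
elim: s q u => [|a s ih] q u //=; congr (_, _) => /=.
  by rewrite (tens_unit_map (b := a ^+ (j - i))) // linearZ_LR /= ih.
rewrite (tens_unit_map (b := 1)) => [|x]; last by rewrite mul1r.
by rewrite scale1r ih.
Qed.

Lemma ext_of_top i s q (u : koszul [seq a ^+ i | a <- s] q) : q < 0 ->
  ext_top (ext_of u) = 0.
Proof.
elim: s q u => [|a s ih] q u q0 /=; first by case: q u q0.
by apply: ih; lia.
Qed.

Lemma ext_wpr_weakly_proregular s : ext_wpr s -> weakly_proregular s.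
Proof.
move=> ws q q0 i; have [J hJ] := ws i.
have hij : (i <= J + i)%N by lia.
exists (J + i)%N, hij => x; rewrite -[x]reprK.
move: (repr x) => z; have /eqP dz := valP z.
apply: etrans (mq_liftE (@coh_bound _ _ _ (koszul_mu hij s) q) z) _.
rewrite -[RHS](linear0 (@mq_proj _ _ (@bound_pred _ _ _))).
apply: mq_pi_eq; rewrite subr0; apply/asboolP => /=.
have [||w dw] := hJ (J + i)%N (leqnn _) (ext_of (val z)).
- exact: ext_of_top.
- by rewrite -(ext_of_d (val z) erefl) [X in ext_of X]dz linear0.
(* [w] need not be homogeneous; its component of degree [q - 1] is a primitive because the
   projections commute with the differentials. *)
exists (koszul_of i (q - 1) w).
by rewrite -koszul_of_d ?subrK // dw -ext_of_mu ext_ofK.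
Qed.
End Comparison.

(** * Passage from local to global *)

Section Patching.
Variables (A : comPzRingType) (K : A -> Prop).
Hypotheses (K0 : K 0) (KD : forall x y, K x -> K y -> K (x + y)).
Hypothesis KM : forall a x, K x -> K (a * x).

(** Each term of the binomial expansion contains [a ^+ n] or [b ^+ m]. *)
Lemma ideal_pow_add a b n m : K (a ^+ n) -> K (b ^+ m) -> K ((a + b) ^+ (n + m)).
Proof.
move=> ha hb; rewrite exprDn; apply: big_ind => // i _.
rewrite -mulr_natl; apply: (KM _); have [mi|im] := leqP m i.
  by rewrite -(subnK mi) exprD; do 2!apply: (KM _).
rewrite mulrC; apply: (KM _); have -> : (n + m - i = (m - i) + n)%N by lia.
by rewrite exprD; apply: (KM _).
Qed.

(** Write 1 as a combination of the elements of [l]; some power of this sum lies in the ideal [K],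
    and every power of 1 is 1. *)
Lemma ideal_patch (l : seq A) : ideal_span [set` l] = setT ->
  (forall t, t \in l -> exists N, K (t ^+ N)) -> K 1.
Proof.
move=> lT hl; have : ideal_span [set` l] 1 by rewrite lT.
case=> u hu e; have [M] : exists M, K ((\sum_(v <- u) v.1 * v.2) ^+ M).
  elim: u hu {e} => [|v u ih] hu; first by exists 1%N; rewrite big_nil.
  have [|M hM] := ih; first by move=> w wu; apply: hu; rewrite inE wu orbT.
  have [N hN] := hl v.2 (hu v (mem_head _ _)).
  exists (N + M)%N; rewrite big_cons; apply: ideal_pow_add => //.
  by rewrite exprMn; apply: (KM _).
by rewrite -e expr1n.
Qed.
End Patching.

(** * Generated ideals *)

Section IdealSpan.
Variable A : comPzRingType.
Implicit Types (S : set A) (l : seq A) (x y a : A).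

Lemma ideal_span0 S : ideal_span S 0.
Proof. by exists [::]; rewrite ?big_nil. Qed.

Lemma ideal_spanD S x y :
  ideal_span S x -> ideal_span S y -> ideal_span S (x + y).
Proof.
move=> [u hu ->] [v hv ->]; exists (u ++ v); last by rewrite big_cat.
by move=> w; rewrite mem_cat => /orP[/hu|/hv].
Qed.

Lemma ideal_spanM S a x : ideal_span S x -> ideal_span S (a * x).
Proof.
move=> [u hu ->]; exists [seq (a * w.1, w.2) | w <- u].
  by move=> _ /mapP[w wu ->]; exact: (hu w).
by rewrite big_map mulr_sumr; apply: eq_bigr => w _; rewrite mulrA.
Qed.

Lemma ideal_span_gen S x : S x -> ideal_span S x.
Proof.
move=> Sx; exists [:: (1, x)]; last by rewrite big_seq1 mul1r.
by move=> w; rewrite inE => /eqP ->.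
Qed.

Lemma ideal_span_min (K : A -> Prop) S x : K 0 ->
  (forall x y, K x -> K y -> K (x + y)) -> (forall a x, K x -> K (a * x)) ->
  (forall y, S y -> K y) -> ideal_span S x -> K x.
Proof.
move=> K0 KD KM SK [u hu ->]; rewrite big_seq.
by apply: big_ind => // w wu; apply: (KM _); apply: SK; apply: hu.
Qed.

Lemma ideal_span1P x y : ideal_span [set x] y -> exists c, y = c * x.
Proof.
move=> xy; apply: (ideal_span_min (K := fun y => exists c, y = c * x) _ _ _ _ xy) => [|_ _ [a ->] [b ->]|a _ [b ->]|_ ->].
- by exists 0; rewrite mul0r.
- by exists (a + b); rewrite mulrDl.
- by exists (a * b); rewrite mulrA.
- by exists 1; rewrite mul1r.
Qed.
End IdealSpan.

(** * Fractions with a power of [t] as denominator *)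

Section AwayFractions.
Variables (A : comPzRingType) (t : A).

Lemma away_in_ker x : away_in t x = 0 -> exists N, t ^+ N * x = 0.
Proof.
move=> /away_piP[k /=]; rewrite addn0 mulr0 => e.
by exists k.
Qed.

Lemma away_inv : exists u : away t, u * away_in t t = 1.
Proof.
exists (\pi_(away t)%qT (1, 1%N)); rewrite [LHS]away_mulE; apply/away_piP.
by exists 0%N; rewrite /= !mul1r mulr1.
Qed.

Lemma away_frac (b : away t) : exists N x, away_in t t ^+ N * b = away_in t x.
Proof.
elim/away_ind: b => x n; exists n, x; rewrite -rmorphXn [LHS]away_mulE.
by apply/away_piP; exists 0%N; rewrite /= !add0n expr0 mul1r.
Qed.

Lemma away_in_lreg : GRing.lreg (away_in t t).
Proof.
have [u e] := away_inv => x y h.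
by rewrite -[x]mul1r -[y]mul1r -e -!mulrA h.
Qed.
End AwayFractions.

(** * Bounded torsion and local generators of [I] *)

Lemma bounded_torsionP (A : comPzRingType) (I : submodClosed A^o) p :
  bounded_torsion (modquot I) p -> exists n, forall k (x : A^o),
    p%:R ^+ k * x \in I -> p%:R ^+ n * x \in I.
Proof.
move=> [n hn]; exists n => k x hx.
have E j : (mq_proj I x *+ p ^ j = 0) <-> (p%:R ^+ j * x \in I).
  have -> : p%:R ^+ j * x = x *+ p ^ j by rewrite -natrX mulr_natl.
  rewrite -raddfMn -(linear0 (mq_proj I)) -[_ *+ _ in X in _ <-> X]subr0.
  by split=> [/mq_eq_pi|/mq_pi_eq].
(* The exponent [k + n] is at least [n] for every [k], also when [k] itself is below the bound. *)
apply/E; have := hn (k + n)%N (leq_addl _ _).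
move=> /seteqP[/(_ (mq_proj I x)) + _]; apply; apply/E.
by rewrite addnC exprD -mulrA; apply: (rpredZ (p%:R ^+ n : A)).
Qed.

Section Cartier.
Variables (A : comPzRingType) (I : submodClosed A^o).

Lemma idealM a (x : A^o) : x \in I -> a * x \in I.
Proof. exact: (rpredZ (a : A)). Qed.

(** The fractions that some power of [t] brings into the image of [I] form an ideal containing that
    image, hence containing [d]. As [t] is a unit in [away t], the resulting [f] is still regular
    and still a generator. *)
Lemma Cartier_generator t (d : away t) : GRing.lreg d ->
    ideal_span (@away_in A t @` ideal_set I) = ideal_span [set d] ->
  exists f, [/\ f \in I, GRing.lreg (away_in t f) &
    forall x, x \in I -> exists c, away_in t x = c * away_in t f].
Proof.
move=> dr dI; have [u ut] := away_inv t.
have [N [f [fI fE]]] : exists N f, f \in I /\ away_in t t ^+ N * d = away_in t f.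
  have : ideal_span (@away_in A t @` ideal_set I) d.
    by rewrite dI; apply: ideal_span_gen.
  move=> dS; apply: (ideal_span_min (K := fun b => exists N f, f \in I /\
      away_in t t ^+ N * b = away_in t f) _ _ _ _ dS).
  - by exists 0%N, 0; rewrite rpred0 mulr0 rmorph0.
  - move=> b c [N [f [fI fE]]] [M [g [gI gE]]].
    exists (N + M)%N, (t ^+ M * f + t ^+ N * g); split.
      by apply: rpredD; apply: idealM.
    by rewrite rmorphD !rmorphM /= -fE -gE !rmorphXn /= exprD; ring.
  - move=> a b [N [f [fI fE]]]; have [M [x xE]] := away_frac a.
    exists (M + N)%N, (x * f); split; first exact: idealM.
    by rewrite rmorphM /= -fE -xE exprD; ring.
  - by move=> _ [f fI <-]; exists 0%N, f; rewrite expr0 mul1r.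
exists f; split=> // [|x xI].
  by rewrite -fE; apply: lregM => //; apply: lregX; apply: away_in_lreg.
have [|c ->] := @ideal_span1P _ d (away_in t x).
  by rewrite -dI; apply: ideal_span_gen; exists x.
exists (c * u ^+ N).
by rewrite -fE mulrA -[c * _ * _]mulrA -exprMn ut expr1n mulr1.
Qed.

Lemma effective_CartierP : effective_Cartier I ->
  exists (l : seq A) (F : A -> A), ideal_span [set` l] = setT /\
    forall t, t \in l -> [/\ F t \in I, GRing.lreg (away_in t (F t)) &
      forall x, x \in I -> exists c, away_in t x = c * away_in t (F t)].
Proof.
move=> [l [lT hl]].
have [t|F hF] := @choice A A (fun t f => t \in l -> [/\ f \in I,
  GRing.lreg (away_in t f) & forall x, x \in I -> exists c, away_in t x = c * away_in t f]).
  (* Outside [l] the value 0 is a default. *)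
  have [/hl[d [dr dI]]|_] := boolP (t \in l); last by exists 0.
  by have [f hf] := Cartier_generator dr dI; exists f.
by exists l, F.
Qed.
End Cartier.

(** * Global generators and gluing *)

Section Main.
Variables (A : comPzRingType) (I : submodClosed A^o) (p : nat) (l : seq A).
Variable F : A -> A.
Hypothesis bd : bounded_torsion (modquot I) p.
Hypothesis l1 : ideal_span [set` l] = setT.
Hypothesis hF : forall t, t \in l -> [/\ F t \in I, GRing.lreg (away_in t (F t)) &
  forall x, x \in I -> exists c, away_in t x = c * away_in t (F t)].

(** For [y] in [I], the [a] with [a * y] in the span form an ideal. It contains a power of each [t]
    in [l], since [y] becomes a multiple of [F t] over [away t]; so it contains 1. *)
Lemma Cartier_span :
  ideal_add (ideal_set I) (ideal_span [set p%:R])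
  = ideal_span [set` rcons (map F l) p%:R].
Proof.
set S := [set` _]; apply/seteqP; split=> [_ [y [z [yI /ideal_span1P[c ->] ->]]]|].
  apply: ideal_spanD; last first.
    by apply/ideal_spanM/ideal_span_gen; rewrite /S /= mem_rcons mem_head.
  suff: ideal_span S (1 * y) by rewrite mul1r.
  apply: (ideal_patch (K := fun a => ideal_span S (a * y)) _ _ _ l1).
  - by rewrite mul0r; apply: ideal_span0.
  - by move=> a b ha hb; rewrite mulrDl; apply: ideal_spanD.
  - by move=> a b hb; rewrite -mulrA; apply: ideal_spanM.
  move=> t tl; have [_ _ /(_ y yI)[b e]] := hF tl.
  have [N [x ex]] := away_frac b.
  have [|M eM] := @away_in_ker _ t (t ^+ N * y - x * F t).
    by rewrite rmorphB !rmorphM rmorphXn /= e -ex mulrA subrr.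
  exists (M + N)%N; move/eqP: eM; rewrite mulrBr subr_eq0 mulrA -exprD => /eqP ->.
  do 2!apply: ideal_spanM; apply: ideal_span_gen.
  by rewrite /S /= mem_rcons inE map_f ?orbT.
move=> x xS; apply: (ideal_span_min _ _ _ _ xS).
- by exists 0, 0; split; [exact: rpred0 | exact: ideal_span0 | rewrite addr0].
- move=> _ _ [y [z [yI zI ->]]] [y' [z' [yI' zI' ->]]].
  exists (y + y'), (z + z'); split; first exact: rpredD.
    exact: ideal_spanD.
  by rewrite addrACA.
- move=> a _ [y [z [yI zI ->]]]; exists (a * y), (a * z); split.
  + exact: idealM.
  + exact: ideal_spanM.
  + by rewrite mulrDr.
- move=> y; rewrite /S /= mem_rcons inE => /predU1P[->|/mapP[t tl ->]].
    exists 0, p%:R; split; [exact: rpred0 | exact: ideal_span_gen | by rewrite add0r].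
  exists (F t), 0; split; [by have [] := hF tl | exact: ideal_span0 | by rewrite addr0].
Qed.

Lemma Cartier_ext_wpr_away t : t \in l ->
  ext_wpr (map (away_in t) (rcons (map F l) p%:R)).
Proof.
move=> tl; have [fI fr Ff] := hF tl; have [n hn] := bounded_torsionP bd.
have [la [lb lE]] : exists la lb, l = la ++ t :: lb.
  by case/splitPr: tl => la lb; exists la, lb.
(* The bound [n] for [A / I] passes to [away t] modulo [F t]: clear denominators, apply the bound in
   [A], and divide by the power of [t] again. *)
have pf : forall k u, (exists c, away_in t p%:R ^+ k * u = c * away_in t (F t)) ->
    exists c, away_in t p%:R ^+ n * u = c * away_in t (F t).
  move=> k u [c e]; have [N [x xE]] := away_frac u; have [M [y yE]] := away_frac c.
  have [|L eL] := @away_in_ker _ t (t ^+ M * (p%:R ^+ k * x) - t ^+ N * (y * F t)).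
    rewrite rmorphB !rmorphM !rmorphXn /= -xE -yE.
    rewrite [away_in t p%:R ^+ k * _]mulrCA e; ring.
  have [|b bE] := Ff (p%:R ^+ n * (t ^+ (L + M) * x)).
    apply: (hn k); rewrite mulrCA exprD -mulrA.
    move/eqP: eL; rewrite mulrBr subr_eq0 => /eqP ->.
    by do 3!apply: idealM.
  have [v vt] := away_inv t; exists (v ^+ (L + M + N) * b).
  rewrite -mulrA -bE !rmorphM !rmorphXn /= -xE.
  rewrite [_ ^+ (L + M) * _]mulrA -exprD [_ ^+ n * (_ * _)]mulrCA [RHS]mulrA.
  by rewrite -exprMn vt expr1n mul1r.
have -> : map (away_in t) (rcons (map F l) p%:R) =
    map (away_in t) (map F la) ++ away_in t (F t) ::
    rcons (map (away_in t) (map F lb)) (away_in t p%:R).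
  by rewrite lE map_rcons !map_cat /= rcons_cat.
apply: (ext_wpr_cat fr pf) => b.
rewrite -!map_cat => /mapP[_ /mapP[t' tl' ->] ->]; apply: Ff.
have t'l : t' \in l by rewrite lE mem_cat inE orbCA -mem_cat tl' orbT.
by have [] := hF t'l.
Qed.

Lemma Cartier_ext_wpr : ext_wpr (rcons (map F l) p%:R).
Proof.
move=> i; set S := rcons _ _.
have [t|J hJ] := @choice A nat (fun t J => t \in l -> forall j, (J + i <= j)%N ->
  forall z : ext S, ext_top z = 0 -> ext_d j z = 0 ->
    exists N w, ext_d i w = t ^+ N *: ext_mu (j - i) z).
  have [tl|_] := boolP (t \in l); last by exists 0%N.
  have [J hJ] := ext_wpr_base (@away_in_ker A t) (@away_frac A t)
    (Cartier_ext_wpr_away tl) i.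
  by exists J.
(* This bound serves all [t] in [l] and does not depend on [z]. *)
exists (\max_(t <- l) J t)%N => j hj z tz dz.
(* With [z] fixed, the scalars that make its image a coboundary form an ideal, so the powers of [t]
   may depend on [z]. *)
have [||||w dw] := ideal_patch (K := fun a => exists w, ext_d i w = a *: ext_mu (j - i) z) _ _ _ l1.
- by exists 0; rewrite scale0r linear0.
- by move=> a b [v dv] [w dw]; exists (v + w); rewrite linearD /= dv dw scalerDl.
- by move=> a b [w dw]; exists (a *: w); rewrite ext_dZ dw scalerA.
- move=> t tl; apply: (hJ t tl j _ z tz dz).
  by apply: leq_trans hj; rewrite leq_add2r; apply: leq_bigmax_seq.
by exists w; rewrite dw scale1r.
Qed.
End Main.

Theorem theorem0p7 (p : nat) (hp : prime p) (A : padic_prism p)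
  (hA : bounded_prism A) :
  weakly_proregular_ideal
    (ideal_add (ideal_set (prism_ideal A)) (ideal_span [set p%:R])).
Proof.
have [l [F [l1 hF]]] := effective_CartierP (prism_Cartier A).
exists (rcons (map F l) p%:R); split; first exact: Cartier_span l1 hF.
exact: ext_wpr_weakly_proregular (Cartier_ext_wpr hA l1 hF).
Qed.
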